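(* There exist uniform constants $A,B>0$ such that, for every finite dimensional Hilbert space $H$, every tight frame of $H$ consisting of vectors in the unit ball of $H$ and having frame bound greater than $1$ can be partitioned into a collection of frames of $H$, each with lower frame bound $A$ and upper frame bound $B$. Furthermore, there exist sequences of constants $(A_n)_{n\in\mathbb{N}}$, $(B_n)_{n\in\mathbb{N}}$ with $\lim_{n\to\infty}A_n=\lim_{n\to\infty}B_n=1$ such that for every $N\in\mathbb{N}$, every finite dimensional Hilbert space $H$, and every tight frame of $H$ consisting of vectors in $N^{-1}B_H$ and having frame bound greater than $1$, the tight frame has a subset which is a frame of $H$ with lower frame bound $A_N$ and upper frame bound $B_N$.
   Context: A collection $(x_j)_{j\in J}$ of vectors in a Hilbert space $H$ is a frame of $H$ with lower frame bound $a>0$ and upper frame bound $b>0$ if $a\|x\|^2\le\sum_{j\in J}|\langle x,x_j\rangle|^2\le b\|x\|^2$ for all $x\in H$. It is a tight frame with frame bound $K$ if one may take $a=b=K$. Partitioning $(x_j)_{j\in J}$ into frames means partitioning the index set $J$ into sets $J_1,J_2,\dots$ such that each $(x_j)_{j\in J_i}$ is a frame of $H$; a subset of $(x_j)_{j\in J}$ means $(x_j)_{j\in J_0}$ for some $J_0\subseteq J$. $B_H=\{x\in H:\|x\|\le1\}$ is the unit ball and $N^{-1}B_H=\{x\in H:\|x\|\le 1/N\}$. Uniform means independent of $H$ and of the frame. *)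

(* Defs.v *)
From HB Require Import structures.
From mathcomp Require Import all_boot all_order all_algebra sesquilinear complex.
From mathcomp Require Import all_classical all_reals ereal topology normedtype.
From mathcomp Require Import sequences esum.

Set Implicit Arguments.
Unset Strict Implicit.
Unset Printing Implicit Defensive.

Import Order.TTheory GRing.Theory Num.Theory.
Import numFieldNormedType.Exports.

Local Open Scope classical_set_scope.
Local Open Scope ring_scope.

(* A Hilbert space may be real or complex.  A finite-dimensional Hilbert space
   is a vectType over [scalar_field R s] with a form
   {dot H for @scalar_conj R s}, which is linear in its first argument and
   positive definite; completeness is automatic in finite dimension. *)
Variant scalars := RealScalars | ComplexScalars.

Definition scalar_field (R : realType) (s : scalars) : numFieldType :=
  match s with
  | RealScalars => R
  | ComplexScalars => R[i]
  end.

Definition scalar_conj (R : realType) (s : scalars) :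
    scalar_field R s -> scalar_field R s :=
  match s with
  | RealScalars => idfun
  | ComplexScalars => @Num.conj R[i]
  end.

Definition scalar_re (R : realType) (s : scalars) : scalar_field R s -> R :=
  match s with
  | RealScalars => idfun
  | ComplexScalars => @complex.Re R
  end.

Section Frames.
Context {R : realType} {s : scalars} {H : vectType (scalar_field R s)}.
Variable dot : {dot H for @scalar_conj R s}.

(* In MathComp the norm `|z| of a scalar is again a scalar (real and
   nonnegative); [scalar_re] brings it back to R. *)
Definition hnorm (x : H) : R := Num.sqrt (scalar_re (dot x x)).

Definition hball (r : R) : set H := [set x | hnorm x <= r].

(* The subfamily of [x] indexed by [J0] is a frame with bounds [a] and [b].
   The index set is arbitrary, possibly infinite or empty. *)
Definition is_frame (J : choiceType) (x : J -> H) (J0 : set J) (a b : R) :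
    Prop :=
  [/\ 0 < a, 0 < b & forall y : H,
    ((a * hnorm y ^+ 2)%:E <=
       \esum_(j in J0) (scalar_re `|dot y (x j)| ^+ 2)%:E <=
       (b * hnorm y ^+ 2)%:E)%E].

Definition is_tight_frame (J : choiceType) (x : J -> H) (K : R) : Prop :=
  is_frame x setT K K.

End Frames.

(* Main.v *)
Require Import Defs.
From HB Require Import structures.
From mathcomp Require Import all_boot all_order all_algebra sesquilinear complex.
From mathcomp Require Import all_classical all_reals ereal topology normedtype.
From mathcomp Require Import sequences esum realfun finmap polyrcf.
From mathcomp Require Import ring lra.

Set Implicit Arguments.
Unset Strict Implicit.
Unset Printing Implicit Defensive.

Import Order.TTheory GRing.Theory Num.Theory.
Import numFieldNormedType.Exports.

Local Open Scope classical_set_scope.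
Local Open Scope ring_scope.

(** The theorem follows from one halving statement, [halving_complex]: if a
finite frame with frame operator S consists of vectors that are individually
small with respect to S, in the sense that the square modulus of [dotc v y] is
at most tau^2 times the quadratic form of S at y, then it splits into two
subfamilies whose frame operators are at most (1 + 7 tau)/2 times S, hence at
least (1 - 7 tau)/2 times S.  This is the solution of the Kadison-Singer
problem by Marcus, Spielman and Srivastava, and it is proved here along their
lines, with functions of a matrix in place of multivariate polynomials.

In dimension 2n, let each vector v choose between w0 = (v, 0) and w1 = (0, v).
Averaging \det (M - sum of the chosen rank one matrices) over all choices gives
a function [mixed_det] of M.  Like the determinant it is [stable]: it is affine
along rank one directions, it has no zero on matrices with positive definite
imaginary part, and along a positive definite direction it is a polynomial with
the leading coefficient of the determinant.  For such a function f, the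
quotient f (X + t U + rank1 w) / f (X + t U) - 1 is a rational function of t
with real simple poles and nonnegative residues ([stable_line]); above its
poles it is therefore nonnegative, decreasing and convex.  Everything else is
drawn from this fact.

- Selection ([selection]).  Call X [above] f if f > 0 on X plus the cone of
  positive semidefinite matrices.  If X is above the mean of two rank one
  translates of f, then it is above one of the two.  So if X is above the mixed
  determinant, then for some choice X minus the chosen sum is positive
  semidefinite ([mixed_det_selection], [above_det_psd]).
- Barrier ([barrier_step]).  Start at a small multiple of E = diag (S, S),
  which is above the determinant.  Each averaging step is paid for by
  moving the point by slightly more than D times the mean of the two rank one
  matrices, with D close to 1; convexity shows that the quotients above do not
  increase, so that the next step is possible.  In the end (1/2 + O(tau)) E is
  above the mixed determinant.

Halving is then iterated ([window_iterate]).  The relative error of a step at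
frame bound a is of the order kappa / sqrt a, where kappa bounds the norms of
the vectors; these errors form a geometric series dominated by its last term,
so that every piece at level a has its bounds within 60 kappa sqrt a of a.  For
the first claim one stops at a constant level a.  For the second one stops at a
level a close to kappa = 1/N and takes the union of about 1/a pieces, whose
total bound is 1 up to an error O(1/sqrt N).  An infinite frame in finite
dimension is, up to an arbitrarily small tail, a finite one ([form_tail]).
Real spaces are handled by passing to complex coordinates. *)

(** * Rational functions with real poles and nonnegative residues *)

Section PartialFractions.
Local Open Scope complex_scope.
Context {R : rcfType}.
Local Notation C := R[i].
Local Notation re := (@complex.Re R).
Local Notation im := (@complex.Im R).
Local Notation cj := (@conjc R).
Local Notation toC p := (map_poly (real_complex R) p).

Lemma conjc_horner (p : {poly R}) (z : C) : cj (toC p).[z] = (toC p).[cj z].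
Proof.
have := horner_map (cj : {rmorphism C -> C}) (toC p) z => /= <-.
rewrite -map_poly_comp; congr (_.[_]).
by apply: eq_map_poly => x /=; rewrite oppr0.
Qed.

Lemma Im_real_horner (h : {poly C}) (x : R) :
  im h.[x%:C] = (map_poly im h).[x].
Proof.
rewrite (horner_coef_wide _ (size_poly _ _ : (size (map_poly _ _) <= size h)%N)).
rewrite horner_coef raddf_sum; apply: eq_bigr => i _.
rewrite coef_map_id0 // -rmorphXn /=.
by case: (h`_i) => a b /=; rewrite mulr0 add0r mulrC.
Qed.

Lemma poly_le0_at0 (k : {poly R}) : (forall e, 0 < e -> k.[e] <= 0) -> k.[0] <= 0.
Proof.
move=> H; rewrite leNgt; apply/negP => k0.
have [d d0 Hd] := poly_cont 0 k k0.
have := Hd (d / 2); rewrite subr0 gtr0_norm ?divr_gt0 //.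
have d2 : d / 2 < d by lra.
move=> /(_ d2); rewrite ltr_norml => /andP[+ _].
have := H (d/2) ltac:(lra); lra.
Qed.

Lemma poly_eq0_fun (k : {poly R}) : (forall t, k.[t] = 0) -> k = 0.
Proof.
move=> k0; apply: (@roots_geq_poly_eq0 _ _ [seq i%:R | i <- iota 0 (size k)]).
- by apply/allP => x _; rewrite /root k0.
- by rewrite map_inj_uniq ?iota_uniq //; exact: mulrIn (oner_neq0 _).
- by rewrite size_map size_iota.
Qed.

Lemma real_poly (p : {poly C}) : (forall t : R, im p.[t%:C] = 0) ->
  p = map_poly (real_complex R) (map_poly re p).
Proof.
move=> p0; have k0 : map_poly im p = 0.
  by apply: poly_eq0_fun => t; rewrite -Im_real_horner p0.
apply/polyP => i; rewrite coef_map /= coef_map_id0 //.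
have := congr1 (fun k : {poly R} => k`_i) k0; rewrite coef_map_id0 // coef0.
by case: (p`_i) => a b /= ->.
Qed.

(** The roots of X^m - c sum to zero when m > 1 and none of them is real, so
they cannot all lie below the real axis. *)
Lemma root_in_upper_half_plane m (c : C) : (1 < m)%N -> (c = 'i \/ c = - 'i) ->
  exists2 w : C, 0 < im w & w ^+ m = c.
Proof.
move=> m1 Hc.
pose P : {poly C} := 'X^m - c%:P.
have m0 : (0 < m)%N by exact: ltnW.
have Pm : P \is monic by apply: monicXnsubC.
have [rs] := closed_field_poly_normal P.
rewrite (monicP Pm) scale1r => PE.
have srs : size rs = m.
  by apply: succn_inj; rewrite -(size_prod_XsubC rs id) -PE size_XnsubC.
have Hroot z : z \in rs -> z ^+ m = c.
  move=> zrs; have : root P z by rewrite PE root_prod_XsubC.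
  by rewrite /root !hornerE subr_eq0 => /eqP.
have sum0 : \sum_(z <- rs) z = 0.
  have := @coefPn_prod_XsubC C rs; rewrite -PE srs -lt0n m0 => /(_ isT).
  rewrite coefB coefXn coefC -subn1 eq_sym.
  rewrite gtn_eqF ?ltn_subrL ?m0 // subn_eq0 leqNgt m1 /= subr0 => /eqP.
  by rewrite eq_sym oppr_eq0 => /eqP.
have nreal z : z \in rs -> im z != 0.
  move=> /Hroot zm; apply/eqP => Iz; move: zm.
  have -> : z = (re z)%:C by case: z Iz => a b /= ->.
  by rewrite -rmorphXn /=; case: Hc => -> [] _ /eqP;
     rewrite eq_sym ?oppr_eq0 oner_eq0.
have [/hasP[z zrs z0]|/hasPn Hn] := boolP (has (fun z : C => 0 < im z) rs).
  by exists z => //; apply: Hroot.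
have rs0 : rs != [::] by rewrite -size_eq0 srs -lt0n.
have : \sum_(z <- rs) - im z = 0.
  by rewrite sumrN -(raddf_sum (im : {additive _ -> _})) sum0 /= oppr0.
case: rs rs0 nreal Hn {PE srs Hroot sum0} => // z rs _ nreal Hn.
rewrite big_cons => /eqP; rewrite paddr_eq0; last 2 first.
- by rewrite oppr_ge0 leNgt Hn ?mem_head.
- rewrite big_seq; apply: sumr_ge0 => y yrs.
  by rewrite oppr_ge0 leNgt Hn // inE yrs orbT.
by rewrite oppr_eq0 (negPf (nreal _ _)) ?mem_head.
Qed.

(** The condition that q / p maps the upper half plane to the closed lower
one, multiplied by the square modulus of p so that no division is needed. *)
Definition antiNevanlinna (p q : {poly R}) :=
  forall z : C, 0 < im z -> im ((toC q).[z] * cj (toC p).[z]) <= 0.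

(** If l is a root of p of multiplicity m, then near l the quotient q / p
behaves like a real constant times (z - l)^(-m).  For m > 1 this takes values
on both sides of the real axis when z runs through the upper half plane; for m
= 1 the sign of the constant is determined.  So every pole is simple with a
positive residue. *)
Lemma antiNevanlinna_residue (p q : {poly R}) (l : R) : antiNevanlinna p q -> p != 0 ->
  root p l -> q.[l] != 0 -> 0 < q.[l] * (p^`()).[l].
Proof.
move=> aN p0 rp ql.
have [m [g]] := multiplicity_XsubC p l.
rewrite p0 /= => gl pE.
have m0 : (0 < m)%N.
  rewrite lt0n; apply: contraNneq gl => m0.
  by move: rp; rewrite pE m0 expr0 mulr1.
have gl0 : g.[l] != 0 by [].
have key (w : C) : 0 < im w -> 0 <= q.[l] * g.[l] * im (w ^+ m).
  move=> w0.
  pose h := ((toC q) \Po (l%:C%:P + w *: 'X)) * ((cj w) ^+ m)%:P *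
            ((toC g) \Po (l%:C%:P + cj w *: 'X)).
  have hE (e : R) : h.[e%:C] = (toC q).[l%:C + w * e%:C] * (cj w) ^+ m *
             cj (toC g).[l%:C + w * e%:C].
    rewrite /h !hornerE !horner_comp !hornerE conjc_horner.
    by rewrite rmorphD rmorphM /= oppr0.
  have : (map_poly im h).[0] <= 0.
    apply: poly_le0_at0 => e e0; rewrite -Im_real_horner hE.
    have Iz : 0 < im (l%:C + w * e%:C).
      by case: (w) w0 => a b /= b0; rewrite mulr0 !add0r mulr_gt0.
    have := aN _ Iz; rewrite pE rmorphM rmorphXn /= map_polyXsubC hornerM horner_exp.
    rewrite !hornerE addrAC subrr add0r.
    set A := (toC q).[_]; set B := (toC g).[_].
    have -> : A * cj (B * (w * e%:C) ^+ m) = (A * cj w ^+ m * cj B) * (e ^+ m)%:C.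
      rewrite rmorphM rmorphXn rmorphM /= oppr0 exprMn rmorphXn /=.
      by move: (cj B) (cj w ^+ m) => u v; ring.
    case: (A * cj w ^+ m * cj B) => a b /=; rewrite mulr0 add0r.
    by rewrite pmulr_lle0 // exprn_gt0.
  rewrite -Im_real_horner hE /= mulr0 addr0.
  have -> : (toC q).[l%:C] = q.[l]%:C by rewrite horner_map.
  have -> : (toC g).[l%:C] = g.[l]%:C by rewrite horner_map.
  rewrite -rmorphXn /=; case: (w ^+ m) => a b /=.
  rewrite !(mul0r, mulr0, oppr0, addr0, subr0, add0r) mulrN mulNr oppr_le0.
  by rewrite mulrAC.
have m1 : m = 1%N.
  apply/eqP; rewrite eqn_leq m0 andbT leqNgt; apply/negP => m2.
  have [w w0 wm] := root_in_upper_half_plane m2 (or_introl erefl).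
  have [w' w0' wm'] := root_in_upper_half_plane m2 (or_intror erefl).
  have := key _ w0; have := key _ w0'; rewrite wm wm' /= mulr1 mulrN1 oppr_ge0.
  move=> h1 h2; have /eqP : q.[l] * g.[l] = 0 by apply/le_anti/andP.
  by rewrite mulf_eq0 (negPf ql) (negPf gl0).
have := key 'i; rewrite m1 expr1 /= mulr1 => /(_ ltr01) k0.
have -> : (p^`()).[l] = g.[l].
  by rewrite pE m1 expr1 derivM derivXsubC !hornerE subrr mulr0 add0r.
by rewrite lt_neqAle k0 andbT eq_sym mulf_neq0.
Qed.

(** A list of pairs (pole, residue) encodes the rational function [pfval], the
sum of c / (X - l) over its entries (l, c); [pfden] and [pfnum] are its
denominator and numerator over the common denominator.  Entries with residue 0
are allowed, and they account for common roots of numerator and denominator.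
*)
Definition pfden (l : seq (R * R)) : {poly R} := \prod_(a <- l) ('X - a.1%:P).

Fixpoint pfnum (l : seq (R * R)) : {poly R} :=
  if l is a :: l' then a.2 *: pfden l' + ('X - a.1%:P) * pfnum l' else 0.

Lemma pfden_cons a l : pfden (a :: l) = ('X - a.1%:P) * pfden l.
Proof. by rewrite /pfden big_cons. Qed.

Lemma pfden_root l x : root (pfden l) x = (x \in map fst l).
Proof. by rewrite /pfden -(big_map fst xpredT (fun a => 'X - a%:P)) root_prod_XsubC. Qed.

Lemma pfnum_residue l a : a \in l ->
  (pfnum l).[a.1] = a.2 * ((pfden l)^`()).[a.1].
Proof.
elim: l => // b l IH; rewrite inE => /predU1P[->|al] /=.
  by rewrite pfden_cons derivM derivXsubC !hornerE subrr !mul0r !addr0.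
have /eqP r0 : root (pfden l) a.1 by rewrite pfden_root map_f.
by rewrite pfden_cons derivM derivXsubC !hornerE r0 IH //; ring.
Qed.

Lemma pf_interpolation (ls : seq R) (q : {poly R}) : uniq ls ->
  (size q <= size ls)%N -> exists2 l, map fst l = ls & pfnum l = q.
Proof.
elim: ls q => [|x ls IH] q /=.
  by move=> _; rewrite leqn0 size_poly_eq0 => /eqP ->; exists [::].
move=> /andP[xls uls] sq.
pose P : {poly R} := \prod_(a <- ls) ('X - a%:P).
have Px : P.[x] != 0 by rewrite -/(root P x) root_prod_XsubC.
pose c := q.[x] / P.[x].
have /factor_theorem[q' q'E] : root (q - c *: P) x.
  by rewrite /root !hornerE /c divfK // subrr.
have sq' : (size q' <= size ls)%N.
  have [->|q'0] := eqVneq q' 0; first by rewrite size_poly0.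
  have : (size (q - c *: P)%R <= (size ls).+1)%N.
    apply: leq_trans (size_polyD _ _) _; rewrite size_polyN geq_max sq.
    by rewrite (leq_trans (size_scale_leq _ _)) // /P size_prod_XsubC.
  by rewrite q'E size_Mmonic ?monicXsubC // size_XsubC addn2.
have [l lE lq'] := IH q' uls sq'.
exists ((x, c) :: l); rewrite /= ?lE ?lq' //.
have -> : pfden l = P by rewrite /pfden -(big_map fst xpredT (fun a => 'X - a%:P)) lE.
by rewrite mulrC -q'E addrC subrK.
Qed.

(** Common roots of p and q are removed one at a time, at the price of a zero
residue.  Once p and q are coprime all poles are simple, the expansion is
Lagrange interpolation, and the residues q / p' are positive. *)
Lemma partial_fractions (ls : seq R) (p q : {poly R}) :
  p = \prod_(a <- ls) ('X - a%:P) -> (size q <= size ls)%N ->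
  antiNevanlinna p q ->
  exists l, [/\ p = pfden l, q = pfnum l & all (fun a => 0 <= a.2) l].
Proof.
have [n] := ubnP (size ls); elim: n ls p q => // n IH ls p q sls pE sq aN.
have [/hasP[x xls /factor_theorem[q' q'E]]|/hasPn nr] := boolP (has (root q) ls).
  have prm := perm_to_rem xls.
  pose p' : {poly R} := \prod_(a <- rem x ls) ('X - a%:P).
  have p'E : p = ('X - x%:P) * p' by rewrite pE (perm_big _ prm) big_cons.
  have srem : size ls = (size (rem x ls)).+1 by rewrite (perm_size prm).
  have [|||l [l1 l2 l3]] := IH (rem x ls) p' q' _ erefl.
  - by rewrite -ltnS -srem.
  - have [->|q'0] := eqVneq q' 0; first by rewrite size_poly0.
    by rewrite -ltnS -srem; move: sq; rewrite q'E size_Mmonic ?monicXsubC // size_XsubC addn2.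
  - move=> z z0; have := aN z z0.
    rewrite q'E p'E !rmorphM /= !map_polyXsubC !hornerM rmorphM /=.
    have -> : ('X - (x%:C)%:P).[z] = z - x%:C :> C by rewrite !hornerE.
    set A := (toC q').[z]; set B := cj _; set D := (z - x%:C).
    have -> : A * D * (cj D * B) = (A * B) * (D * cj D) by ring.
    have D0 : 0 < (im D) by rewrite /D; case: (z) z0 => a b /=; rewrite subr0.
    have -> : D * cj D = ((re D) ^+ 2 + (im D) ^+ 2)%:C.
      by case: (D) => a b; apply/eqP; rewrite eq_complex /=; apply/andP; split; apply/eqP; ring.
    case: (A * B) => a b /=; rewrite mulr0 add0r pmulr_lle0 //.
    by rewrite ltr_wpDl ?sqr_ge0 ?exprn_gt0.
  exists ((x, 0) :: l); split; rewrite ?pfden_cons /= -?l1 -?l2 ?scale0r ?add0r //.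
    by rewrite q'E mulrC.
  by rewrite lexx.
have p0 : p != 0 by rewrite pE monic_neq0 ?monic_prod_XsubC.
have rp x : x \in ls -> root p x by rewrite pE root_prod_XsubC.
have pos x : x \in ls -> 0 < q.[x] * (p^`()).[x].
  by move=> xls; apply: antiNevanlinna_residue (nr _ _) => //; apply: rp.
have uls : uniq ls.
  apply: count_mem_uniq => x; case: (boolP (x \in ls)) => [xls|/count_memPn -> //].
  have prm := perm_to_rem xls.
  rewrite (permP prm) /= eqxx; congr (_ + _)%N; apply/count_memPn.
  apply: contraTN (pos x xls) => xr.
  have /eqP r0 : root (\prod_(a <- rem x ls) ('X - a%:P)) x by rewrite root_prod_XsubC.
  rewrite pE (perm_big _ prm) big_cons derivM derivXsubC !hornerE r0 subrr mul0r.
  by rewrite addr0 mulr0 ltxx.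
have [l lE qE] := pf_interpolation uls sq.
have plE : pfden l = p.
  by rewrite pE /pfden -(big_map fst xpredT (fun a => 'X - a%:P)) lE.
exists l; split=> //; apply/allP => a al.
have := pos a.1; rewrite -lE map_f // => /(_ isT).
rewrite -qE pfnum_residue // plE -mulrA -expr2 => H.
have : 0 <= (p^`()).[a.1] ^+ 2 by exact: sqr_ge0.
rewrite le_eqVlt => /orP[/eqP e0|e0]; first by move: H; rewrite -e0 mulr0 ltxx.
by rewrite ltW // -(pmulr_lgt0 _ e0).
Qed.

Lemma pfden_gt0 l t : all (fun a => a.1 < t) l -> 0 < (pfden l).[t].
Proof.
move=> lt.
rewrite /pfden horner_prod big_seq; apply: prodr_gt0 => a al.
by rewrite !hornerE subr_gt0 (allP lt).
Qed.

Lemma pfnum_ge0 l t : all (fun a => 0 <= a.2) l ->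
  all (fun a => a.1 <= t) l -> 0 <= (pfnum l).[t].
Proof.
elim: l => [|a l IH] /=; first by rewrite hornerE.
move=> /andP[a2 l2] /andP[a1 l1]; rewrite !hornerE addr_ge0 ?mulr_ge0 ?subr_ge0 ?IH //.
rewrite /pfden horner_prod big_seq; apply: prodr_ge0 => b bl.
by rewrite !hornerE subr_ge0 (allP l1).
Qed.

Definition pfval (l : seq (R * R)) (t : R) := \sum_(a <- l) a.2 / (t - a.1).

Lemma pfvalE l t : all (fun a => a.1 < t) l ->
  (pfnum l).[t] = (pfden l).[t] * pfval l t.
Proof.
elim: l => [|a l IH] /=; first by rewrite /pfval big_nil mulr0 hornerE.
move=> /andP[a1 l1]; rewrite /pfval big_cons pfden_cons !hornerE IH //.
have ta : t - a.1 != 0 by rewrite subr_eq0 gt_eqF.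
by rewrite -/(pfval l t); field.
Qed.

Lemma pfval_ge0 l t : all (fun a => 0 <= a.2) l -> all (fun a => a.1 < t) l ->
  0 <= pfval l t.
Proof.
move=> c0 l0; rewrite /pfval big_seq; apply: sumr_ge0 => a al.
by rewrite divr_ge0 ?(allP c0) // subr_ge0 ltW // (allP l0).
Qed.

Lemma pfval_nonincr l s t : all (fun a => 0 <= a.2) l -> all (fun a => a.1 < s) l ->
  s <= t -> pfval l t <= pfval l s.
Proof.
move=> c0 l0 st; rewrite /pfval big_seq [leRHS]big_seq; apply: ler_sum => a al.
have := allP l0 _ al => as_; apply: ler_wpM2l; first exact: (allP c0).
by rewrite lef_pV2 ?posrE; lra.
Qed.

(** Minus the derivative of [pfval]. *)
Definition pfslope (l : seq (R * R)) (t : R) := \sum_(a <- l) a.2 / (t - a.1) ^+ 2.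

Lemma pfslope_ge0 l t : all (fun a => 0 <= a.2) l -> 0 <= pfslope l t.
Proof.
move=> c0; rewrite /pfslope big_seq; apply: sumr_ge0 => a al.
by rewrite divr_ge0 ?(allP c0) // sqr_ge0.
Qed.

(** The quotient rule for numerator and denominator, cleared of division. *)
Lemma pfslopeE l t : all (fun a => a.1 < t) l ->
  (pfnum l).[t] * (pfden l)^`().[t] - (pfnum l)^`().[t] * (pfden l).[t] =
  (pfden l).[t] ^+ 2 * pfslope l t.
Proof.
elim: l => [|a l IH] /=; first by rewrite /pfslope big_nil linear0 horner0 => _; ring.
move=> /andP[a1 l1]; rewrite /pfslope big_cons -/(pfslope l t) pfden_cons.
rewrite derivD derivZ !derivM derivXsubC !(hornerD, hornerM, hornerZ, hornerN, hornerX, hornerC) mul1r.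
have {}IH := IH l1.
have ta : t - a.1 != 0 by rewrite subr_eq0 gt_eqF.
set N := (pfnum l).[t] in IH *; set N' := (pfnum l)^`().[t] in IH *.
set D := (pfden l).[t] in IH *; set D' := (pfden l)^`().[t] in IH *.
transitivity (a.2 * D ^+ 2 + (t - a.1) ^+ 2 * (N * D' - N' * D)); [by ring|].
by rewrite IH; field.
Qed.

(** The graph of [pfval] lies above its tangent at t.  Termwise, with x = s -
l <= y = t - l, this is 1 / (x y) >= 1 / y^2. *)
Lemma pfval_convex l s t : all (fun a => 0 <= a.2) l -> all (fun a => a.1 < s) l ->
  s <= t -> (t - s) * pfslope l t <= pfval l s - pfval l t.
Proof.
move=> c0 l0 st; rewrite /pfslope /pfval -sumrB mulr_sumr.
rewrite big_seq [leRHS]big_seq; apply: ler_sum => a al.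
have := allP l0 _ al => as_; have := allP c0 _ al => a0.
have -> : a.2 / (s - a.1) - a.2 / (t - a.1) =
  (t - s) * (a.2 / ((s - a.1) * (t - a.1))).
  by field; apply/andP; split; rewrite subr_eq0 gt_eqF //; lra.
apply: ler_wpM2l; first by lra.
apply: ler_wpM2l => //; rewrite lef_pV2 ?posrE; last 2 first.
- by rewrite exprn_gt0 //; lra.
- by rewrite mulr_gt0 //; lra.
by rewrite expr2; apply: ler_wpM2r; lra.
Qed.

Lemma pfden_neg (l : seq (R * R)) : (forall t, 0 <= t -> (pfden l).[t] != 0) ->
  all (fun a => a.1 < 0) l.
Proof.
move=> H; apply/allP => a al; rewrite ltNge; apply/negP => /H.
by rewrite -/(root _ _) pfden_root map_f.
Qed.

Lemma all_lt_trans (l : seq (R * R)) s t : all (fun a => a.1 < s) l -> s <= t ->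
  all (fun a => a.1 < t) l.
Proof. by move=> /allP H st; apply/allP => a /H /lt_le_trans; apply. Qed.

End PartialFractions.

(** * Stable functions of a Hermitian matrix *)

Lemma affine_mean_identity (F : fieldType) (z a b c d : F) :
  2^-1 * ((1 - z) * a + z * b + ((1 - z) * c + z * d)) =
  (1 - z) * (2^-1 * (a + c)) + z * (2^-1 * (b + d)).
Proof. by ring. Qed.

Lemma exists_max (R : rcfType) (s : seq R) x :
  x \in s -> exists2 m, m \in s & all (fun z : R => z <= m) s.
Proof.
elim: s x => // a s IH x _; case: s IH => [|b s] IH.
  by exists a; rewrite ?mem_head //= lexx.
have [m ms /= Hm] := IH b (mem_head _ _).
have [am|ma] := lerP a m; [exists m|exists a].
- by rewrite inE ms orbT.
- by rewrite /= am.
- by rewrite mem_head.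
rewrite /= lexx /=; move: Hm => /andP[bm /allP Hm]; rewrite (le_trans bm (ltW ma)) /=.
by apply/allP => y /Hm /le_trans; apply; apply: ltW.
Qed.

(** The inequality behind one step of the barrier argument.  Here a and aw are
the values of f at the new point Y and at Y + rank1 w, S and T the
corresponding mean values over the two rank one translates, sl the slope of
the quotient at Y, and r its value at the old point. *)
Lemma barrier_arith (R : rcfType) (a aw S T D r sl : R) : 0 < a -> 0 < D -> 0 <= sl ->
  D * (aw * S - a * T) <= sl * a ^+ 2 -> sl <= r - aw / a ->
  a <= D * (2 * a - S) -> (2 * aw - T) / (2 * a - S) <= r.
Proof.
move=> a0 D0 sl0 H1 H2 H3.
have den : 0 < 2 * a - S by rewrite -(pmulr_rgt0 _ D0); apply: lt_le_trans H3.
have awE : aw = (aw / a) * a by rewrite divfK // gt_eqF.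
set q := aw / a in awE H2; rewrite ler_pdivrMr //.
apply: (@le_trans _ _ ((sl + q) * (2 * a - S))); last first.
  by apply: ler_wpM2r; [exact: ltW|lra].
have H4 : D * (q * S - T) <= sl * a.
  rewrite -(ler_pM2r a0); move: H1; rewrite awE; lra.
have H5 : D * (q * S - T) <= D * (sl * (2 * a - S)).
  apply: le_trans H4 _; rewrite mulrCA; exact: ler_wpM2l.
move: H5; rewrite ler_pM2l // awE; lra.
Qed.

Section Matrices.
Local Open Scope complex_scope.
Context {R : rcfType}.
Local Notation C := R[i].
Local Notation re := (@complex.Re R).
Local Notation im := (@complex.Im R).
Local Notation cj := (@conjc R).

Definition adjmx m n (M : 'M[C]_(m, n)) : 'M[C]_(n, m) := (map_mx cj M)^T.

Lemma adjmxK m n (M : 'M[C]_(m, n)) : adjmx (adjmx M) = M.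
Proof. by apply/matrixP => i j; rewrite !mxE conjcK. Qed.

Lemma adjmxM m n p (M : 'M[C]_(m, n)) (N : 'M[C]_(n, p)) :
  adjmx (M *m N) = adjmx N *m adjmx M.
Proof. by rewrite /adjmx map_mxM trmx_mul. Qed.

Lemma adjmxD m n (M N : 'M[C]_(m, n)) : adjmx (M + N) = adjmx M + adjmx N.
Proof. by rewrite /adjmx map_mxD linearD. Qed.

Lemma adjmxN m n (M : 'M[C]_(m, n)) : adjmx (- M) = - adjmx M.
Proof. by rewrite /adjmx map_mxN linearN. Qed.

Lemma adjmxZ m n (z : C) (M : 'M[C]_(m, n)) : adjmx (z *: M) = cj z *: adjmx M.
Proof. by rewrite /adjmx map_mxZ linearZ. Qed.

Definition sqmod (z : C) : R := re z ^+ 2 + im z ^+ 2.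

Lemma sqmod_ge0 z : 0 <= sqmod z.
Proof. by rewrite addr_ge0 ?sqr_ge0. Qed.

Lemma conjM_sqmod z : cj z * z = (sqmod z)%:C.
Proof.
by case: z => a b; apply/eqP; rewrite eq_complex /sqmod /=; apply/andP; split; apply/eqP; ring.
Qed.

Section Fixed.
Context {n : nat}.
Implicit Types (M N Z U : 'M[C]_n) (u w y : 'cV[C]_n).

Definition qform M y : C := (adjmx y *m M *m y) 0 0.
Definition rank1 w : 'M[C]_n := w *m adjmx w.
Definition dotc w y : C := (adjmx w *m y) 0 0.

Lemma qformD M N y : qform (M + N) y = qform M y + qform N y.
Proof. by rewrite /qform mulmxDr mulmxDl mxE. Qed.

Lemma qformN M y : qform (- M) y = - qform M y.
Proof. by rewrite /qform mulmxN mulNmx mxE. Qed.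

Lemma qformZ z M y : qform (z *: M) y = z * qform M y.
Proof. by rewrite /qform -scalemxAr -scalemxAl mxE. Qed.

Lemma qform0 y : qform 0 y = 0.
Proof. by rewrite /qform mulmx0 mul0mx mxE. Qed.

Lemma qform_sum I (r : seq I) (F : I -> 'M[C]_n) y :
  qform (\sum_(i <- r) F i) y = \sum_(i <- r) qform (F i) y.
Proof.
by elim: r => [|i r IH]; rewrite ?big_nil ?qform0 // !big_cons qformD IH.
Qed.

Lemma cj_dotc w y : cj (dotc w y) = dotc y w.
Proof.
have : adjmx (adjmx w *m y) 0 0 = dotc y w by rewrite adjmxM adjmxK.
by move <-; rewrite mxE mxE.
Qed.

Lemma qform_rank1 w y : qform (rank1 w) y = (sqmod (dotc w y))%:C.
Proof.
rewrite /qform /rank1 !mulmxA -mulmxA mxE big_ord1 -/(dotc y w) -/(dotc w y).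
by rewrite -cj_dotc conjM_sqmod.
Qed.

Lemma qform_adj M y : qform (adjmx M) y = cj (qform M y).
Proof.
have : adjmx (adjmx y *m M *m y) 0 0 = qform (adjmx M) y.
  by rewrite !adjmxM adjmxK mulmxA.
by move <-; rewrite mxE mxE.
Qed.

Definition hermitian M := adjmx M = M.

Lemma hermitian_qform M y : hermitian M -> qform M y = (re (qform M y))%:C.
Proof.
move=> hM; have := qform_adj M y; rewrite hM; case: (qform M y) => a b /= [] /eqP.
by rewrite -subr_eq0 opprK -mulr2n mulrn_eq0 /= => /eqP ->.
Qed.

Lemma hermitian_rank1 w : hermitian (rank1 w).
Proof. by rewrite /hermitian /rank1 adjmxM adjmxK. Qed.

Lemma hermitianD M N : hermitian M -> hermitian N -> hermitian (M + N).
Proof. by rewrite /hermitian adjmxD => -> ->. Qed.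

Lemma hermitianN M : hermitian M -> hermitian (- M).
Proof. by rewrite /hermitian adjmxN => ->. Qed.

Lemma hermitianZ (c : R) M : hermitian M -> hermitian (c%:C *: M).
Proof. by rewrite /hermitian adjmxZ /= oppr0 => ->. Qed.

Lemma hermitian0 : hermitian 0.
Proof. by apply/matrixP => i j; rewrite !mxE /= oppr0. Qed.

Lemma hermitian_sum I (r : seq I) (F : I -> 'M[C]_n) :
  (forall i, hermitian (F i)) -> hermitian (\sum_(i <- r) F i).
Proof. by move=> H; elim/big_rec: _ => [|i M _]; [exact: hermitian0|apply: hermitianD]. Qed.

Definition upper M := forall y, y != 0 -> 0 < im (qform M y).
Definition posdef M := forall y, y != 0 -> 0 < re (qform M y).

Lemma upper_rank1 M (z : C) w : upper M -> 0 <= im z -> upper (M + z *: rank1 w).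
Proof.
move=> uM z0 y y0; rewrite qformD qformZ qform_rank1 /= raddfD /=.
rewrite ltr_wpDr ?uM //; case: z z0 => a b /= b0.
by rewrite mulr0 add0r mulr_ge0 ?sqmod_ge0.
Qed.

Lemma upper_line Z U (z : C) : hermitian Z -> hermitian U -> posdef U ->
  0 < im z -> upper (Z + z *: U).
Proof.
move=> hZ hU pU z0 y y0; rewrite qformD qformZ raddfD /=.
rewrite (hermitian_qform y hZ) (hermitian_qform y hU) /= add0r.
by case: z z0 => a b /= b0; rewrite mulr0 add0r mulr_gt0 // pU.
Qed.

(** M + z w w^* is a Schur complement in a block matrix whose last row depends
on z in an affine way. *)
Lemma det_rank1 M w (z : C) :
  \det (M + z *: rank1 w) = (1 - z) * \det M + z * \det (M + rank1 w).
Proof.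
pose B z := block_mx M (- w) (z *: adjmx w) (1%:M : 'M[C]_1).
have BE z' : \det (B z') = \det (M + z' *: rank1 w).
  have -> : B z' = block_mx (M + z' *: rank1 w) (- w) 0 1%:M *m
                   block_mx 1%:M 0 (z' *: adjmx w) 1%:M.
    rewrite mulmx_block !mulmx1 !mul1mx !mulmx0 !add0r.
    by rewrite mulNmx -scalemxAr addrK.
  by rewrite det_mulmx det_ublock det_lblock !det1 !mulr1.
have := BE z; have := BE 0; have := BE 1; rewrite scale0r addr0 scale1r => <- <- <-.
have rE (z' : C) : row (rshift n 0) (B z') = row_mx (z' *: adjmx w) 1%:M.
  by rewrite /B /block_mx rowKd; apply/rowP => j; rewrite mxE.
apply: (@determinant_multilinear _ _ _ _ _ (rshift n 0)).
- rewrite !rE !scale_row_mx add_row_mx scale0r scaler0 add0r scale1r.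
  by rewrite -scalerDl subrK scale1r.
- by apply/matrixP => i j; rewrite !mxE; case: splitP => // k kE;
    case/eqP: (neq_lift (rshift n 0) i); apply: val_inj; apply: etrans (esym kE); rewrite ord1.
- by apply/matrixP => i j; rewrite !mxE; case: splitP => // k kE;
    case/eqP: (neq_lift (rshift n 0) i); apply: val_inj; apply: etrans (esym kE); rewrite ord1.
Qed.

Lemma anisotropic_unitmx M : (forall y, y != 0 -> qform M y != 0) -> M \in unitmx.
Proof.
move=> aM; rewrite -unitmx_tr -row_free_unit -kermx_eq0; apply/negPn/negP => /rowV0Pn[v].
move=> /sub_kermxP vM v0.
have y0 : v^T != 0 by rewrite trmx_eq0.
have := aM _ y0; rewrite /qform -mulmxA.
have -> : M *m v^T = 0 by apply: trmx_inj; rewrite trmx_mul trmxK vM trmx0.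
by rewrite mulmx0 mxE eqxx.
Qed.

Lemma upper_unitmx M : upper M -> M \in unitmx.
Proof.
by move=> uM; apply: anisotropic_unitmx => y /uM; apply: contraTneq => ->; rewrite ltxx.
Qed.

Lemma posdef_unitmx M : posdef M -> M \in unitmx.
Proof.
by move=> pM; apply: anisotropic_unitmx => y /pM; apply: contraTneq => ->; rewrite ltxx.
Qed.

(** The properties of the determinant that survive averaging over rank one
translates.  Affinity along rank one directions replaces the usual
multi-affine polynomials; the last field fixes degree and leading coefficient
along every nondegenerate line. *)
Record stable (f : 'M[C]_n -> C) : Prop := Stable {
  stable_affine : forall M w z,
    f (M + z *: rank1 w) = (1 - z) * f M + z * f (M + rank1 w);
  stable_adj : forall M, f (adjmx M) = cj (f M);
  stable_neq0 : forall M, upper M -> f M != 0;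
  stable_lead : forall Z U, U \in unitmx -> exists p : {poly C},
    [/\ (size p <= n.+1)%N, p`_n = 1 & forall t, f (Z + t *: U) = \det U * p.[t]]
}.

Lemma stable_det : stable (fun M => \det M).
Proof.
split.
- exact: det_rank1.
- by move=> M; rewrite /adjmx det_tr det_map_mx.
- by move=> M /upper_unitmx; rewrite unitmxE unitfE.
- move=> Z U uU; exists (char_poly (- (invmx U *m Z))); split.
  + by rewrite size_char_poly.
  + by have /monicP := char_poly_monic (- (invmx U *m Z)); rewrite lead_coefE size_char_poly.
  + move=> t; rewrite /char_poly -[(\det _).[t]]/(horner_eval t _) -det_map_mx -det_mulmx.
    congr (\det _); rewrite /char_poly_mx map_mxB map_scalar_mx /= /horner_eval hornerX.
    have -> : map_mx (horner_eval t) (map_mx polyC (- (invmx U *m Z))) = - (invmx U *m Z).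
      by apply/matrixP => i j; rewrite !mxE /horner_eval hornerC.
    by rewrite opprK mulmxDr mulmxA mulmxV // mul1mx mul_mx_scalar addrC.
Qed.

Definition shift_mean f u0 u1 M : C := 2^-1 * (f (M - rank1 u0) + f (M - rank1 u1)).

Lemma stable_sub f M w : stable f -> f (M - rank1 w) = 2 * f M - f (M + rank1 w).
Proof. by move=> [fa _ _ _]; rewrite -scaleN1r fa; ring. Qed.

(** By affinity f (M + z rank1 w) = f M (1 + z r), and if r is nonzero with
nonnegative imaginary part, then z = - 1/r is in the closed upper half plane,
where there must be no zero. *)
Lemma stable_ratio f M w : stable f -> upper M ->
  let r := f (M + rank1 w) / f M - 1 in r = 0 \/ im r < 0.
Proof.
move=> sf uM r; have f0 := stable_neq0 sf uM.
have [r0|r0] := eqVneq r 0; [by left|right].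
rewrite ltNge; apply/negP => ir.
have iz : 0 <= im (- r^-1).
  case: (r) ir r0 => a b /= b0 _; rewrite opprK divr_ge0 //.
  by rewrite addr_ge0 ?sqr_ge0.
have := stable_neq0 sf (upper_rank1 w uM iz); rewrite (stable_affine sf).
have -> : f (M + rank1 w) = (r + 1) * f M by rewrite /r subrK divfK.
have -> : (1 - - r^-1) * f M + - r^-1 * ((r + 1) * f M) = f M * (1 - r^-1 * r) by ring.
by rewrite mulVf // subrr mulr0 eqxx.
Qed.

(** With r0, r1 as in [stable_ratio], a zero of the mean would give r0 + r1 =
2, while the sum has negative imaginary part unless it is 0. *)
Lemma stable_shift_mean f u0 u1 : stable f -> stable (shift_mean f u0 u1).
Proof.
move=> sf; split.
- move=> M w z; rewrite /shift_mean.
  have E N u : M + N - rank1 u = M - rank1 u + N by rewrite addrAC.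
  rewrite !E (stable_affine sf (M - rank1 u0)) (stable_affine sf (M - rank1 u1)).
  exact: affine_mean_identity.
- move=> M; rewrite /shift_mean.
  have E u : adjmx M - rank1 u = adjmx (M - rank1 u).
    by rewrite adjmxD adjmxN hermitian_rank1.
  have c2 : cj 2^-1 = 2^-1 by rewrite fmorphV rmorph_nat.
  by rewrite !E !(stable_adj sf) (rmorphM cj) (rmorphD cj) /= -[in LHS]c2.
- move=> M uM; have f0 := stable_neq0 sf uM.
  have := stable_ratio u0 sf uM; have := stable_ratio u1 sf uM => /=.
  set r1 := _ - 1; set r0 := _ - 1 => h1 h0.
  have E1 : f (M + rank1 u1) = (r1 + 1) * f M by rewrite /r1 subrK divfK.
  have E0 : f (M + rank1 u0) = (r0 + 1) * f M by rewrite /r0 subrK divfK.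
  rewrite /shift_mean !stable_sub // E1 E0.
  rewrite (_ : 2^-1 * _ = f M * 2^-1 * (2 - (r0 + r1))); last by ring.
  rewrite mulf_neq0 ?mulf_neq0 ?invr_eq0 ?pnatr_eq0 //.
  apply/eqP => /eqP; rewrite subr_eq0 => /eqP E.
  have : im (r0 + r1) = 0 by rewrite -E -(rmorph_nat (real_complex R)).
  rewrite raddfD /=; case: h0 h1 => [z0|l0] [z1|l1]; rewrite ?z0 ?z1 /=; try lra.
  by move=> _; move/eqP: E; rewrite z0 z1 addr0 pnatr_eq0.
- move=> Z U uU.
  have [p0 [s0 m0 E0]] := stable_lead sf (Z - rank1 u0) uU.
  have [p1 [s1 m1 E1]] := stable_lead sf (Z - rank1 u1) uU.
  exists (2^-1 *: (p0 + p1)); split.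
  + apply: leq_trans (size_scale_leq _ _) _; apply: leq_trans (size_polyD _ _) _.
    by rewrite geq_max s0 s1.
  + by rewrite coefZ coefD m0 m1; field.
  + move=> t; rewrite /shift_mean (addrAC Z _ (- rank1 u0)) E0.
    by rewrite (addrAC Z _ (- rank1 u1)) E1 hornerZ hornerD; ring.
Qed.

Lemma stable_real f M : stable f -> hermitian M -> im (f M) = 0.
Proof.
move=> sf hM; have := stable_adj sf M; rewrite hM.
by case: (f M) => a b [] /eqP; rewrite -subr_eq0 opprK -mulr2n mulrn_eq0 /= => /eqP.
Qed.

Lemma real_complexE (z : C) : im z = 0 -> z = (re z)%:C.
Proof. by case: z => a b /= ->. Qed.

Lemma hermitian_det M : hermitian M -> \det M = (re (\det M))%:C.
Proof. by move=> hM; apply: real_complexE; exact: (stable_real stable_det). Qed.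

Lemma hermitian_line Z U (t : R) : hermitian Z -> hermitian U ->
  hermitian (Z + t%:C *: U).
Proof. by move=> hZ hU; apply: hermitianD => //; apply: hermitianZ. Qed.

(** Along a line with positive definite direction f is a real polynomial all
of whose roots are real, because non-real roots come in conjugate pairs and
stability excludes the upper half plane.  By [stable_ratio] the numerator and
denominator satisfy [antiNevanlinna], so that [partial_fractions] applies. *)
Lemma stable_line f Z U w : stable f -> hermitian Z -> hermitian U -> posdef U ->
  exists l, all (fun a => 0 <= a.2) l /\
    (forall t : R, f (Z + t%:C *: U) = \det U * (pfden l).[t]%:C /\
      f (Z + t%:C *: U + rank1 w) - f (Z + t%:C *: U) = \det U * (pfnum l).[t]%:C).
Proof.
move=> sf hZ hU pU; have uU := posdef_unitmx pU.
have dU0 : \det U != 0 by rewrite -unitfE -unitmxE.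
have dUr : im (\det U) = 0 by exact: (stable_real stable_det).
have [p [sp lp pE]] := stable_lead sf Z uU.
have [p' [sp' lp' pE']] := stable_lead sf (Z + rank1 w) uU.
have realval g (k : {poly C}) W : stable g -> hermitian W ->
    (forall t, g (W + t *: U) = \det U * k.[t]) -> k = map_poly (real_complex R) (map_poly re k).
  move=> sg hW gE; apply: real_poly => t.
  have : im (g (W + t%:C *: U)) = 0 by apply: stable_real => //; apply: hermitian_line.
  rewrite gE (real_complexE dUr); case: (k.[_]) => a b /= /eqP.
  rewrite mul0r addr0 mulf_eq0 => /orP[/eqP d0|/eqP //].
  by move: dU0; rewrite (real_complexE dUr) d0 eqxx.
have pR := realval _ _ _ sf hZ pE.
have pR' := realval _ _ _ sf (hermitianD hZ (hermitian_rank1 w)) pE'.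
set q0 := map_poly re p in pR; set q1 := map_poly re p' in pR'.
have szp : size p = n.+1.
  apply/eqP; rewrite eqn_leq sp ltnNge; apply/negP => /leq_sizeP/(_ n (leqnn n))/eqP.
  by rewrite lp oner_eq0.
have pm : p \is monic by rewrite monicE lead_coefE szp /= lp.
have [rs] := closed_field_poly_normal p; rewrite (monicP pm) scale1r => prs.
(* a zero at z gives one at the conjugate of z, and one of the two is in the upper half plane *)
have rs_real z : z \in rs -> z = (re z)%:C.
  move=> zrs; have rz : p.[z] = 0.
    by apply/eqP; rewrite -/(root p z) prs root_prod_XsubC.
  have fz : f (Z + z *: U) = 0 by rewrite pE rz mulr0.
  have fz' : f (Z + cj z *: U) = 0.
    have -> : Z + cj z *: U = adjmx (Z + z *: U) by rewrite adjmxD adjmxZ hZ hU.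
    by rewrite (stable_adj sf) fz rmorph0.
  apply: real_complexE; apply/eqP; case: (ltrgtP (im z) 0) => // iz.
    have : 0 < im (cj z) by case: (z) iz => a b /=; rewrite oppr_gt0.
    by move=> /(upper_line hZ hU pU)/(stable_neq0 sf); rewrite fz' eqxx.
  by move: iz => /(upper_line hZ hU pU)/(stable_neq0 sf); rewrite fz eqxx.
have srs : size rs = n by apply: succn_inj; rewrite -szp prs size_prod_XsubC.
have q0E : q0 = \prod_(a <- map re rs) ('X - a%:P).
  apply: (@map_inj_poly _ _ (real_complex R)) => [x y [] //||].
    by [].
  rewrite -pR prs rmorph_prod big_map big_seq [RHS]big_seq; apply: eq_bigr => z zrs.
  by rewrite [RHS]map_polyXsubC; congr ('X - _%:P); exact: rs_real.
have sq : (size (q1 - q0)%R <= size (map re rs))%N.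
  rewrite size_map srs; apply/leq_sizeP => j; rewrite leq_eqVlt => /predU1P[<-|jn].
    by rewrite coefB !coef_map_id0 // lp lp' subrr.
  rewrite coefB !coef_map_id0 // !(nth_default 0) ?subrr //=.
    exact: leq_trans sp jn.
  exact: leq_trans sp' jn.
have aN : antiNevanlinna q0 (q1 - q0).
  move=> z z0; rewrite rmorphB /= hornerD hornerN -pR -pR'.
  have uz := upper_line hZ hU pU z0.
  have fz := stable_neq0 sf uz.
  have pz : p.[z] != 0 by apply: contraNneq fz => pz; rewrite pE pz mulr0.
  have -> : (p'.[z] - p.[z]) * cj p.[z] =
     (f (Z + z *: U + rank1 w) / f (Z + z *: U) - 1) * (cj p.[z] * p.[z]).
    by rewrite addrAC pE' pE; field; rewrite pz.
  have := stable_ratio w sf uz => /=; set r := _ - 1.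
  rewrite conjM_sqmod; case=> [->|]; first by rewrite mul0r.
  case: (r) => a b /= b0; rewrite mulr0 add0r.
  by rewrite mulr_le0_ge0 ?sqmod_ge0 // ltW.
have [l [l1 l2 l3]] := partial_fractions q0E sq aN.
exists l; split => // t; rewrite -l1 -l2 addrAC pE' pE -mulrBr.
have v0 : p.[t%:C] = q0.[t]%:C by rewrite pR horner_map.
have v1 : p'.[t%:C] = q1.[t]%:C by rewrite pR' horner_map.
by rewrite hornerD hornerN v0 v1; split => //; rewrite rmorphB.
Qed.

Implicit Types (X : 'M[C]_n) (f : 'M[C]_n -> C) (l : seq (R * 'cV[C]_n)).
(** Nonnegative combinations of rank one matrices stand for positive
semidefinite matrices, because rank one affinity is what allows one to move
along them. *)
Definition wsum l : 'M[C]_n := \sum_(a <- l) a.1%:C *: rank1 a.2.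
Definition nonneg_weights l := all (fun a => 0 <= a.1) l.

Lemma wsum_cons a l : wsum (a :: l) = a.1%:C *: rank1 a.2 + wsum l.
Proof. by rewrite /wsum big_cons. Qed.

Lemma wsum_nil : wsum [::] = 0.
Proof. by rewrite /wsum big_nil. Qed.

Lemma wsum_cat l1 l2 : wsum (l1 ++ l2) = wsum l1 + wsum l2.
Proof. by rewrite /wsum big_cat. Qed.

Definition rescale (c : R) l := [seq (c * a.1, a.2) | a <- l].

Lemma wsum_rescale c l : wsum (rescale c l) = c%:C *: wsum l.
Proof.
rewrite /wsum /rescale big_map scaler_sumr; apply: eq_bigr => a _ /=.
by rewrite scalerA -rmorphM.
Qed.

Lemma nonneg_rescale c l : 0 <= c -> nonneg_weights l -> nonneg_weights (rescale c l).
Proof.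
by move=> c0 /allP l0; apply/allP => _ /mapP[a /l0 a0 ->]; rewrite mulr_ge0.
Qed.

Lemma hermitian_wsum l : hermitian (wsum l).
Proof.
by apply: hermitian_sum => a; apply: hermitianZ; apply: hermitian_rank1.
Qed.

Lemma re_mulr (c : R) (z : C) : re (c%:C * z) = c * re z.
Proof. by case: z => a b /=; rewrite mul0r subr0. Qed.

Lemma reD (z z' : C) : re (z + z') = re z + re z'.
Proof. by case: z; case: z'. Qed.

Lemma re_sum I (r : seq I) (F : I -> C) :
  re (\sum_(i <- r) F i) = \sum_(i <- r) re (F i).
Proof. by elim/big_ind2: _ => // x a y b <- <-; rewrite reD. Qed.

Lemma qform_wsum_ge0 l y : nonneg_weights l -> 0 <= re (qform (wsum l) y).
Proof.
move=> /allP l0; rewrite /wsum qform_sum re_sum big_seq; apply: sumr_ge0 => a al.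
by rewrite qformZ qform_rank1 re_mulr /= mulr_ge0 ?l0 ?sqmod_ge0.
Qed.

Lemma posdef_scale (c : R) U : 0 < c -> posdef U -> posdef (c%:C *: U).
Proof. by move=> c0 pU y y0; rewrite qformZ re_mulr mulr_gt0 ?pU. Qed.

Lemma posdefD_wsum U l : posdef U -> nonneg_weights l -> posdef (U + wsum l).
Proof.
move=> pU l0 y y0; rewrite qformD reD ltr_wpDr ?pU //.
exact: qform_wsum_ge0.
Qed.

Lemma posdef1 : posdef (1%:M : 'M[C]_n).
Proof.
move=> y y0; rewrite /qform mulmx1 mxE re_sum.
have pos i : 0 <= re (adjmx y 0 i * y i 0) by rewrite !mxE conjM_sqmod /= sqmod_ge0.
rewrite lt_neqAle sumr_ge0 ?andbT //.
apply: contraNneq y0 => /esym/eqP; rewrite psumr_eq0 // => /allP y0.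
apply/eqP/colP => i; have := y0 i (mem_index_enum i).
rewrite !mxE conjM_sqmod /= paddr_eq0 ?sqr_ge0 // !sqrf_eq0.
by case: (y i 0) => a b /= /andP[/eqP -> /eqP ->].
Qed.

(** The polynomial \det (U + t 1) has only negative roots and leading
coefficient 1. *)
Lemma posdef_det U : hermitian U -> posdef U -> 0 < re (\det U).
Proof.
move=> hU pU.
have h1 : hermitian (1%:M : 'M[C]_n).
  by rewrite /hermitian /adjmx map_mx1 trmx1.
have [l [l1 lE]] := stable_line 0 stable_det hU h1 posdef1.
have n0 : all (fun a => a.1 < 0) l.
  apply: pfden_neg => t t0.
  have pt : posdef (U + t%:C *: 1%:M).
    move=> y y0; rewrite qformD reD qformZ re_mulr ltr_wpDr ?pU //.
    by rewrite mulr_ge0 // ltW ?posdef1.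
  have := posdef_unitmx pt; rewrite unitmxE unitfE (lE t).1 det1 mul1r.
  by apply: contraNneq => ->.
have := (lE 0).1; rewrite scale0r addr0 det1 mul1r => -> /=.
exact: pfden_gt0.
Qed.

Lemma re_affine f M w (c : R) : stable f ->
  re (f (M + c%:C *: rank1 w)) = re (f M) + c * (re (f (M + rank1 w)) - re (f M)).
Proof.
move=> sf; rewrite (stable_affine sf) reD re_mulr.
have -> : 1 - c%:C = (1 - c)%:C :> C by rewrite rmorphB.
by rewrite re_mulr; ring.
Qed.

Lemma re_line f Z U w : stable f -> hermitian Z -> hermitian U -> posdef U ->
  exists (d : R) (l : seq (R * R)), [/\ 0 < d, all (fun a => 0 <= a.2) l &
    forall t : R, re (f (Z + t%:C *: U)) = d * (pfden l).[t] /\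
      re (f (Z + t%:C *: U + rank1 w)) = d * ((pfden l).[t] + (pfnum l).[t])].
Proof.
move=> sf hZ hU pU; have [l [l0 lE]] := stable_line w sf hZ hU pU.
exists (re (\det U)), l; split => //; first exact: posdef_det.
move=> t; have [E1 E2] := lE t; have dE := hermitian_det hU; split.
  by rewrite E1 dE re_mulr.
have -> : f (Z + t%:C *: U + rank1 w) =
    f (Z + t%:C *: U) + (f (Z + t%:C *: U + rank1 w) - f (Z + t%:C *: U)).
  by rewrite [RHS]addrC subrK.
by rewrite E2 E1 dE reD !re_mulr mulrDr.
Qed.

Lemma re_line_pos f Z U w : stable f -> hermitian Z -> hermitian U -> posdef U ->
  (forall t, 0 <= t -> re (f (Z + t%:C *: U)) != 0) ->
  exists (d : R) (l : seq (R * R)), [/\ 0 < d, all (fun a => 0 <= a.2) l, all (fun a => a.1 < 0) l &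
    forall t : R, re (f (Z + t%:C *: U)) = d * (pfden l).[t] /\
      re (f (Z + t%:C *: U + rank1 w)) = d * ((pfden l).[t] + (pfnum l).[t])].
Proof.
move=> sf hZ hU pU f0; have [d [l [d0 l0 lE]]] := re_line w sf hZ hU pU.
exists d, l; split => //; apply: pfden_neg => t t0.
by have := f0 t t0; rewrite (lE t).1; apply: contraNneq => ->; rewrite mulr0.
Qed.

(** * Points above the zeros of a stable function *)

(** X is above f if f is positive at X and at everything larger in the
positive semidefinite order. *)
Definition above f X := forall l, nonneg_weights l -> 0 < re (f (X + wsum l)).

(** It suffices to avoid the zeros of f on one ray with positive definite
direction.  Adding a rank one matrix with weight c multiplies f by 1 + c r,
where r >= 0 beyond the largest pole, so the whole ray stays free of zeros and
one proceeds by induction over the summands. *)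
Lemma garding f Z U : stable f -> hermitian Z -> hermitian U -> posdef U ->
  (forall t, 0 <= t -> re (f (Z + t%:C *: U)) != 0) -> above f Z.
Proof.
move=> sf hZ hU pU f0 l.
elim: l Z hZ f0 => [|[c w] l IH] Z hZ f0 /=.
  move=> _; rewrite wsum_nil addr0.
  have [d [l [d0 l0 ln lE]]] := re_line_pos 0 sf hZ hU pU f0.
  have := (lE 0).1; rewrite scale0r addr0 => ->.
  by rewrite mulr_gt0 // pfden_gt0.
move=> /andP[/= c0 l0]; rewrite wsum_cons addrA; apply: IH => //.
  by apply: hermitianD => //; apply: hermitianZ; apply: hermitian_rank1.
move=> t t0; have [d [l' [d0 l0' ln lE]]] := re_line_pos w sf hZ hU pU f0.
have [E1 E2] := lE t.
have lt := all_lt_trans ln t0.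
rewrite addrAC re_affine // E2 E1; apply: lt0r_neq0.
have -> : d * (pfden l').[t] + c * (d * ((pfden l').[t] + (pfnum l').[t]) - d * (pfden l').[t])
  = d * ((pfden l').[t] + c * (pfnum l').[t]) by ring.
rewrite mulr_gt0 // ltr_wpDr ?pfden_gt0 // mulr_ge0 // pfvalE //.
by rewrite mulr_ge0 ?pfval_ge0 // ltW ?pfden_gt0.
Qed.

Lemma above_wsum f X l : above f X -> nonneg_weights l -> above f (X + wsum l).
Proof.
by move=> aX l0 k k0; rewrite -addrA -wsum_cat aX // /nonneg_weights all_cat; apply/andP.
Qed.

Lemma above_line f X l t : above f X -> nonneg_weights l -> 0 <= t ->
  0 < re (f (X + t%:C *: wsum l)).
Proof. by move=> aX l0 t0; rewrite -wsum_rescale aX // nonneg_rescale. Qed.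

Lemma re_sub f M w : stable f ->
  re (f (M - rank1 w)) = 2 * re (f M) - re (f (M + rank1 w)).
Proof.
move=> sf; rewrite -scaleN1r (_ : -1 = (-1)%:C) ?re_affine //; last by rewrite rmorphN.
by ring.
Qed.

Lemma re_shift_mean f u0 u1 M : stable f -> re (shift_mean f u0 u1 M) =
  2 * re (f M) - 2^-1 * (re (f (M + rank1 u0)) + re (f (M + rank1 u1))).
Proof.
move=> sf; rewrite /shift_mean.
have -> : 2^-1 = (2^-1 : R)%:C :> C by rewrite fmorphV rmorph_nat.
by rewrite re_mulr reD !re_sub //; field.
Qed.

(** Since the translates of f by u0 and u1 are f (1 - r0) and f (1 - r1) with
decreasing r0 and r1, it suffices that one of r0, r1 is less than 1 at X;
otherwise the mean of the translates would not be positive there.  That f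
itself has no zero on the ray from X is seen at its largest zero, where the
mean of the translates equals minus the mean of the two numerators, which is
at most 0. *)
Lemma selection f u0 u1 X lE : stable f -> hermitian X ->
  nonneg_weights lE -> posdef (wsum lE) ->
  above (shift_mean f u0 u1) X -> above f (X - rank1 u0) \/ above f (X - rank1 u1).
Proof.
move=> sf hX lE0 pE aX; have hE := hermitian_wsum lE.
have [d0 [l0 [d0p l0c l0E]]] := re_line u0 sf hX hE pE.
have [d1 [l1 [d1p l1c l1E]]] := re_line u1 sf hX hE pE.
have noroot t : 0 <= t -> re (f (X + t%:C *: wsum lE)) != 0.
  move=> t0; apply/negP => ft0.
  have rt : t \in map fst l0.
    move: ft0; rewrite (l0E t).1 mulf_eq0 gt_eqF //= => ft0.
    by rewrite -pfden_root.
  (* at the largest zero of f both numerators are nonnegative *)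
  have [m ml0 Hm] := exists_max rt.
  have m0 : 0 <= m by apply: le_trans t0 _; apply: (allP Hm).
  have fm : re (f (X + m%:C *: wsum lE)) = 0.
    by rewrite (l0E m).1; move: ml0; rewrite -pfden_root => /eqP ->; rewrite mulr0.
  have l1m : all (fun a => a.1 <= m) l1.
    apply/allP => a al1; have : root (pfden l1) a.1 by rewrite pfden_root map_f.
    move=> /eqP r1; have := (l0E a.1).1; rewrite (l1E a.1).1 r1 mulr0 => /esym/eqP.
    rewrite mulf_eq0 gt_eqF //= -/(root _ _) pfden_root => al0.
    exact: (allP Hm).
  have l0m : all (fun a => a.1 <= m) l0 by rewrite all_map in Hm.
  have := above_line aX lE0 m0; rewrite re_shift_mean // fm mulr0 sub0r oppr_gt0.
  apply/negP; rewrite -leNgt mulr_ge0 ?invr_ge0 // (l0E m).2 (l1E m).2.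
  move: (l0E m).1 (l1E m).1; rewrite fm => /esym/eqP + /esym/eqP.
  rewrite !mulf_eq0 (gt_eqF d0p) (gt_eqF d1p) /= => /eqP -> /eqP ->; rewrite !add0r.
  by apply: addr_ge0; rewrite mulr_ge0 ?pfnum_ge0 // ltW.
have step u (d : R) (l : seq (R * R)) : 0 < d -> all (fun a => 0 <= a.2) l ->
  (forall t : R, re (f (X + t%:C *: wsum lE)) = d * (pfden l).[t] /\
     re (f (X + t%:C *: wsum lE + rank1 u)) = d * ((pfden l).[t] + (pfnum l).[t])) ->
  re (f (X + rank1 u)) < 2 * re (f X) -> above f (X - rank1 u).
  move=> dp lc lv fu.
  have ln : all (fun a => a.1 < 0) l.
    apply: pfden_neg => t t0; have := noroot t t0.
    by rewrite (lv t).1; apply: contraNneq => ->; rewrite mulr0.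
  have v0 : pfval l 0 < 1.
    move: fu (lv 0); rewrite scale0r addr0 => fu [E1 E2].
    move: fu; rewrite E1 E2 pfvalE // -subr_gt0.
    rewrite (_ : _ - _ = d * (pfden l).[0] * (1 - pfval l 0)); last by ring.
    by rewrite pmulr_rgt0 ?subr_gt0 // mulr_gt0 // pfden_gt0.
  apply: (garding sf _ hE pE).
    by apply: hermitianD => //; apply: hermitianN; apply: hermitian_rank1.
  move=> t t0; have lt := all_lt_trans ln t0; have [E1 E2] := lv t.
  rewrite addrAC re_sub // E1 E2 pfvalE //; apply: lt0r_neq0.
  rewrite (_ : _ - _ = d * (pfden l).[t] * (1 - pfval l t)); last by ring.
  rewrite mulr_gt0 ?mulr_gt0 ?pfden_gt0 // subr_gt0.
  by apply: le_lt_trans v0; apply: pfval_nonincr.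
have := aX [::] isT; rewrite wsum_nil addr0 re_shift_mean // => H.
have [h0|h0] := ltrP (re (f (X + rank1 u0))) (2 * re (f X)).
  by left; apply: step h0; [exact: d0p|exact: l0c|].
by right; apply: step d1p l1c l1E _; lra.
Qed.

(** * The barrier argument *)

(** One plus the logarithmic derivative of f in the direction [rank1 w]; by
affinity the derivative is a finite difference. *)
Definition ratio f w X : R := re (f (X + rank1 w)) / re (f X).

Section DirectionalDerivative.
Variable g : 'M[C]_n -> R.
Hypothesis g_affine : forall X w (c : R),
  g (X + c%:C *: rank1 w) = g X + c * (g (X + rank1 w) - g X).

Definition ddir l X : R := \sum_(a <- l) a.1 * (g (X + rank1 a.2) - g X).

Lemma affine_along l X : exists k : {poly R},
  (forall t : R, g (X + t%:C *: wsum l) = k.[t]) /\ k^`().[0] = ddir l X.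
Proof.
elim: l X => [|[c w] l IH] X.
  exists (g X)%:P; split=> [t|]; first by rewrite wsum_nil scaler0 addr0 hornerC.
  by rewrite derivC horner0 /ddir big_nil.
have [k1 [E1 D1]] := IH X; have [k2 [E2 D2]] := IH (X + rank1 w).
exists (k1 + (c *: 'X) * (k2 - k1)); split=> [t|].
  rewrite wsum_cons scalerDr scalerA -rmorphM addrCA addrC g_affine E1.
  rewrite addrAC E2 !(hornerD, hornerM, hornerZ, hornerN, hornerX) /=; ring.
rewrite derivD derivM derivZ derivX !(hornerD, hornerM, hornerZ, hornerN, hornerX, hornerC).
rewrite -E1 -E2 D1 scale0r !addr0 /ddir big_cons /=; ring.
Qed.

(** A function that is affine along rank one directions is polynomial along
their combinations, and its derivative there is the combination of the finite
differences. *)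
Lemma deriv_line l X (P : {poly R}) (s : R) :
  (forall t : R, g (X + t%:C *: wsum l) = P.[t]) ->
  P^`().[s] = ddir l (X + s%:C *: wsum l).
Proof.
move=> PE; have [k [kE <-]] := affine_along l (X + s%:C *: wsum l).
have -> : k = P \Po ('X + s%:P).
  apply/eqP; rewrite -subr_eq0; apply/eqP; apply: poly_eq0_fun => t.
  rewrite hornerD hornerN horner_comp !hornerE -kE -PE -addrA -scalerDl.
  by rewrite -rmorphD [t + s]addrC subrr.
rewrite deriv_comp derivD derivX derivC addr0 mulr1 horner_comp.
by rewrite !hornerE.
Qed.
End DirectionalDerivative.

Lemma ddir_cons g a l X : ddir g (a :: l) X =
  a.1 * (g (X + rank1 a.2) - g X) + ddir g l X.
Proof. by rewrite /ddir big_cons. Qed.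

Lemma ddir_rescale g c l X : ddir g (rescale c l) X = c * ddir g l X.
Proof.
by rewrite /ddir /rescale big_map mulr_sumr; apply: eq_bigr => a _ /=; rewrite mulrA.
Qed.

(** The decreasing convex shape of [ratio] along a ray, together with its
slope expressed by directional derivatives. *)
Lemma ratio_line f w X l : stable f -> hermitian X -> nonneg_weights l ->
  posdef (wsum l) -> above f X ->
  exists L : seq (R * R), [/\ all (fun a => 0 <= a.2) L, all (fun a => a.1 < 0) L,
    (forall t : R, 0 <= t -> ratio f w (X + t%:C *: wsum l) = 1 + pfval L t) &
    (forall t : R, 0 <= t -> let Y := X + t%:C *: wsum l in
     re (f (Y + rank1 w)) * ddir (fun M => re (f M)) l Y -
     re (f Y) * ddir (fun M => re (f (M + rank1 w))) l Y =
     re (f Y) ^+ 2 * pfslope L t)].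
Proof.
move=> sf hX l0 pl aX.
have f0 t : 0 <= t -> re (f (X + t%:C *: wsum l)) != 0.
  by move=> t0; apply: lt0r_neq0; apply: above_line.
have [d [L [d0 Lc Ln LE]]] := re_line_pos w sf hX (hermitian_wsum l) pl f0.
exists L; split => // t t0.
  have [E1 E2] := LE t; have lt := all_lt_trans Ln t0.
  have p0 := pfden_gt0 lt.
  rewrite /ratio E1 E2 pfvalE //; field.
  by rewrite !gt_eqF.
move=> Y; have [E1 E2] := LE t; have lt := all_lt_trans Ln t0.
have aff1 Z u (c : R) : re (f (Z + c%:C *: rank1 u)) =
    re (f Z) + c * (re (f (Z + rank1 u)) - re (f Z)) by exact: re_affine.
have aff2 Z u (c : R) : re (f (Z + c%:C *: rank1 u + rank1 w)) =
    re (f (Z + rank1 w)) + c * (re (f (Z + rank1 u + rank1 w)) - re (f (Z + rank1 w))).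
  by rewrite addrAC (re_affine (Z + rank1 w) u c sf) (addrAC Z (rank1 w)).
have H1 : forall t : R, re (f (X + t%:C *: wsum l)) = (d *: pfden L).[t].
  by move=> s; rewrite hornerZ (LE s).1.
have H2 : forall t : R, re (f (X + t%:C *: wsum l + rank1 w)) = (d *: (pfden L + pfnum L)).[t].
  by move=> s; rewrite hornerZ hornerD (LE s).2.
rewrite -(deriv_line aff1 t H1) -(deriv_line aff2 t H2) E1 E2.
have S := pfslopeE lt.
rewrite !derivZ derivD !(hornerZ, hornerD).
transitivity (d ^+ 2 * ((pfden L).[t] ^+ 2 * pfslope L t)); last by ring.
by rewrite -S; ring.
Qed.

Section Barrier.
Variables (f : 'M[C]_n -> C) (u0 u1 : 'cV[C]_n) (lE : seq (R * 'cV[C]_n)) (D eta : R).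
Hypotheses (sf : stable f) (lE0 : nonneg_weights lE) (pE : posdef (wsum lE)).
Hypotheses (D0 : 0 < D) (eta0 : 0 < eta).

(** D times the mean of [rank1 u0] and [rank1 u1], plus a multiple of the
fixed positive definite matrix [wsum lE].  The second part makes the direction
positive definite, as [stable_line] requires; it can be taken arbitrarily
small. *)
Definition barrier_shift : seq (R * 'cV[C]_n) :=
  (D / 2, u0) :: (D / 2, u1) :: rescale (D * eta) lE.

Lemma nonneg_barrier_shift : nonneg_weights barrier_shift.
Proof.
rewrite /nonneg_weights /= !divr_ge0 ?ltW //=.
by apply: nonneg_rescale => //; rewrite mulr_ge0 ?ltW.
Qed.

Lemma posdef_barrier_shift : posdef (wsum barrier_shift).
Proof.
rewrite /barrier_shift -[_ :: _]/([:: (D / 2, u0); (D / 2, u1)] ++ rescale (D * eta) lE).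
rewrite wsum_cat addrC; apply: posdefD_wsum.
  by rewrite wsum_rescale; apply: posdef_scale => //; rewrite mulr_gt0.
by rewrite /nonneg_weights /= !divr_ge0 ?ltW.
Qed.

(** Write Phi for the mean of [ratio f u0] and [ratio f u1], minus 1.  Then
the new function is f (1 - Phi), and its logarithmic derivative in direction w
exceeds that of f by minus the w-derivative of Phi, divided by 1 - Phi.  Mixed
differences being symmetric, this excess is the downward slope of [ratio f w]
in the direction of the mean of the two rank one matrices, over 1 - Phi >=
1/D.  By convexity, moving by D times that direction decreases [ratio f w] at
least as much. *)
Lemma barrier_step X : hermitian X -> above f X ->
  ratio f u0 X + ratio f u1 X <= 2 * (2 - D^-1) ->
  above (shift_mean f u0 u1) (X + wsum barrier_shift) /\
  forall w, ratio (shift_mean f u0 u1) w (X + wsum barrier_shift) <= ratio f w X.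
Proof.
move=> hX aX Hr; set lU := barrier_shift.
have lU0 : nonneg_weights lU := nonneg_barrier_shift.
have pU : posdef (wsum lU) := posdef_barrier_shift.
have hU := hermitian_wsum lU.
have hX' : hermitian (X + wsum lU) by apply: hermitianD.
have aX' : above f (X + wsum lU) by apply: above_wsum.
have XU0 : X = X + 0%:C *: wsum lU by rewrite scale0r addr0.
have XU1 : X + wsum lU = X + 1%:C *: wsum lU by rewrite scale1r.
have ratio_decr t : 0 <= t ->
    ratio f u0 (X + t%:C *: wsum lU) + ratio f u1 (X + t%:C *: wsum lU) <= 2 * (2 - D^-1).
  move=> t0; apply: le_trans Hr.
  have decr u : ratio f u (X + t%:C *: wsum lU) <= ratio f u X.
    have [L [Lc Ln LE _]] := ratio_line u sf hX lU0 pU aX.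
    by rewrite {2}XU0 !LE // lerD2l pfval_nonincr.
  exact: lerD.
have mean_ge t Y : 0 <= t -> Y = X + t%:C *: wsum lU ->
    re (f Y) <= D * (2 * re (f Y) - 2^-1 * (re (f (Y + rank1 u0)) + re (f (Y + rank1 u1)))).
  move=> t0 YE; have fY : 0 < re (f Y) by rewrite YE; exact: above_line.
  have E u : re (f (Y + rank1 u)) = ratio f u Y * re (f Y).
    by rewrite /ratio divfK // gt_eqF.
  rewrite !E -mulrDl -[leLHS]mul1r.
  rewrite [leRHS](_ : _ = (D * (2 - 2^-1 * (ratio f u0 Y + ratio f u1 Y))) * re (f Y)); last by ring.
  apply: ler_wpM2r; first exact: ltW.
  rewrite -ler_pdivrMl // mulr1; have := ratio_decr t t0; rewrite -YE; lra.
split.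
  apply: (garding (stable_shift_mean u0 u1 sf) hX' hU pU) => t t0.
  have t1 : 0 <= 1 + t by rewrite addr_ge0.
  rewrite -addrA -{1}[wsum lU]scale1r -scalerDl -[1%R]/(1%:C) -rmorphD re_shift_mean //.
  have mt := mean_ge _ _ t1 erefl.
  apply: lt0r_neq0; rewrite -(pmulr_rgt0 _ D0); apply: lt_le_trans mt.
  exact: above_line.
move=> w; set Y := X + wsum lU.
have mY := mean_ge 1 Y ler01 XU1.
have [L [Lc Ln LE LS]] := ratio_line w sf hX lU0 pU aX.
have [K [Kc Kn _ KS]] := ratio_line w sf hX' lE0 pE aX'.
rewrite [in leLHS]/ratio !re_shift_mean //.
have fY : 0 < re (f Y) by exact: (aX lU).
apply: (@barrier_arith _ _ _ _ _ D _ (pfslope L 1)) => //.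
- exact: pfslope_ge0.
- have := LS 1 ler01; rewrite -XU1 -/Y /= [X in _ = X]mulrC => <-.
  have := KS 0 (lexx 0); rewrite scale0r addr0 -/Y /= => KE.
  have K0 : 0 <= re (f Y) ^+ 2 * pfslope K 0.
    by rewrite mulr_ge0 ?sqr_ge0 // pfslope_ge0.
  rewrite /lU /barrier_shift !ddir_cons !ddir_rescale /=.
  move: KE K0; set dE := ddir _ lE Y; set dE' := ddir _ lE Y => <- K0.
  have K1 : 0 <= D * eta * (re (f (Y + rank1 w)) * dE - re (f Y) * dE').
    by apply: mulr_ge0 => //; apply: mulr_ge0; apply: ltW.
  (* the part of the slope along wsum lE is nonnegative by K1 and is dropped *)
  rewrite (addrAC Y (rank1 w) (rank1 u0)) (addrAC Y (rank1 w) (rank1 u1)); lra.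
- have c := @pfval_convex _ L 0 1 Lc Ln ler01.
  have := LE 1 ler01; rewrite -XU1 -/Y -[re _ / _]/(ratio f w Y) => ->.
  by have := LE 0 (lexx 0); rewrite -XU0 => ->; lra.
Qed.
End Barrier.

(** * Mixed determinants *)

(** Two block triangular factorizations of the same matrix. *)
Lemma det_1D_rank1 (v : 'cV[C]_n) (x : 'rV[C]_n) :
  \det (1%:M + v *m x) = 1 + (x *m v) 0 0.
Proof.
pose B := block_mx 1%:M (- v) x (1%:M : 'M[C]_1).
have B1 : B = block_mx (1%:M + v *m x) (- v) 0 1%:M *m block_mx 1%:M 0 x 1%:M.
  by rewrite mulmx_block !mulmx1 !mul1mx !mulmx0 !add0r mulNmx addrK.
have B2 : B = block_mx 1%:M 0 x 1%:M *m block_mx 1%:M (- v) 0 (1%:M + x *m v).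
  rewrite mulmx_block !mulmx1 !mul1mx ?mulmx0 ?mul0mx !addr0 ?add0r.
  by rewrite mulmxN [1%:M + _]addrC addKr.
have : \det B = \det (1%:M + v *m x).
  by rewrite B1 det_mulmx det_ublock det_lblock !det1 !mulr1.
move=> <-; rewrite B2 det_mulmx det_ublock det_lblock !det1 !mul1r det_mx11.
by rewrite !mxE.
Qed.

Lemma det_D_rank1 M w : M \in unitmx ->
  \det (M + rank1 w) = \det M * (1 + dotc w (invmx M *m w)).
Proof.
move=> uM; have -> : M + rank1 w = M *m (1%:M + (invmx M *m w) *m adjmx w).
  by rewrite mulmxDr mulmx1 !mulmxA mulmxV // mul1mx.
by rewrite det_mulmx det_1D_rank1.
Qed.

(** If the form of M were negative at y, then \det (M + c rank1 (M y)) = \det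
M (1 + c q) would vanish for a suitable c >= 0, where q is the value of the
form at y. *)
Lemma above_det_psd M : hermitian M -> above (fun N => \det N) M ->
  forall y, 0 <= re (qform M y).
Proof.
move=> hM aM y; rewrite leNgt; apply/negP => q0.
have dM := aM [::] isT; rewrite wsum_nil addr0 in dM.
have uM : M \in unitmx.
  by rewrite unitmxE unitfE; apply: contraTneq dM => ->; rewrite ltxx.
set q := re _ in q0.
pose c := - q^-1; have c0 : 0 <= c by rewrite oppr_ge0 invr_le0 ltW.
have := aM [:: (c, M *m y)]; rewrite /nonneg_weights /= c0 => /(_ isT).
rewrite wsum_cons wsum_nil addr0 re_affine; last exact: stable_det.
rewrite det_D_rank1 // mulmxA mulVmx // mul1mx.
have -> : dotc (M *m y) y = q%:C by rewrite /dotc adjmxM hM -hermitian_qform.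
rewrite (hermitian_det hM) re_mulr reD /= /c.
rewrite (_ : _ + _ = 0) ?ltxx //; field; exact: ltr0_neq0.
Qed.

(** For y = M^-1 w both [dotc w y] and the form of M at y are equal to w^*
M^-1 w =: q, so the hypothesis reads q^2 <= c q. *)
Lemma ratio_det_le M w (c : R) : 0 <= c -> hermitian M -> posdef M ->
  (forall y, sqmod (dotc w y) <= c * re (qform M y)) ->
  ratio (fun N => \det N) w M <= 1 + c.
Proof.
move=> c0 hM pM wM; have uM := posdef_unitmx pM.
have dM := posdef_det hM pM.
set y := invmx M *m w.
have My : M *m y = w by rewrite mulmxA mulmxV // mul1mx.
have Dq : dotc w y = qform M y by rewrite -{1}My /dotc adjmxM hM /qform.
have q0 : 0 <= re (qform M y).
  by have [->|y0] := eqVneq y 0; [rewrite /qform mulmx0 mxE|rewrite ltW ?pM].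
have := wM y; rewrite Dq (hermitian_qform y hM) /sqmod /= expr0n addr0 => qc.
rewrite /ratio det_D_rank1 // -/y (hermitian_det hM) re_mulr reD /= mulrAC divff ?gt_eqF //.
rewrite mul1r Dq lerD2l; have [->//|q1] := eqVneq (re (qform M y)) 0.
have qp : 0 < re (qform M y) by rewrite lt_neqAle eq_sym q1.
by rewrite -(ler_pM2r qp) -expr2.
Qed.

Section MixedDeterminant.
Implicit Types lE : seq (R * 'cV[C]_n).
Variables (J : eqType) (w : bool -> J -> 'cV[C]_n).

(** The mean of \det (M - sum of rank1 (w (b j) j)) over all choices b, built
one index at a time. *)
Definition mixed_det (s : seq J) : 'M[C]_n -> C :=
  foldr (fun j f => shift_mean f (w false j) (w true j)) (fun M => \det M) s.

Lemma stable_mixed_det s : stable (mixed_det s).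
Proof. by elim: s => [|j s IH]; [exact: stable_det|apply: stable_shift_mean]. Qed.

Lemma mixed_det_selection lE s X : nonneg_weights lE -> posdef (wsum lE) ->
  uniq s -> hermitian X -> above (mixed_det s) X ->
  exists b : J -> bool,
    above (fun M => \det M) (X - \sum_(j <- s) rank1 (w (b j) j)).
Proof.
move=> lE0 pE; elim: s X => [|j s IH] X.
  by move=> _ _ aX; exists xpredT; rewrite big_nil subr0.
move=> /= /andP[js us] hX aX.
have [c ac] : exists c, above (mixed_det s) (X - rank1 (w c j)).
  by case: (selection (stable_mixed_det s) hX lE0 pE aX) => a; [exists false|exists true].
have hXc : hermitian (X - rank1 (w c j)).
  by apply: hermitianD => //; apply: hermitianN; apply: hermitian_rank1.
have [b ab] := IH _ us hXc ac.
exists (fun i => if i == j then c else b i); rewrite big_cons eqxx opprD addrA.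
rewrite (_ : \sum_(i <- s) _ = \sum_(i <- s) rank1 (w (b i) i)) //.
by apply: eq_big_seq => i si; case: eqP => // ij; rewrite -ij si in js.
Qed.

(** Since the quotients [ratio] never increase along the way, the condition of
[barrier_step] need only be checked for the determinant at the starting point
t E, where it says c / t <= 1 - 1/D. *)
Lemma mixed_det_barrier lE s (t D eta c : R) : nonneg_weights lE -> posdef (wsum lE) ->
  0 <= c -> 0 < t -> 0 < D -> 0 < eta -> c / t <= 1 - D^-1 ->
  (forall b j y, j \in s -> sqmod (dotc (w b j) y) <= c * re (qform (wsum lE) y)) ->
  above (mixed_det s) (t%:C *: wsum lE +
    \sum_(j <- s) wsum (barrier_shift (w false j) (w true j) lE D eta)).
Proof.
move=> lE0 pE c0 t0 D0 e0 ct wc; set M := t%:C *: wsum lE.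
have hM : hermitian M by apply: hermitianZ; apply: hermitian_wsum.
have pM : posdef M by apply: posdef_scale.
pose X (r : seq J) := M + \sum_(j <- r) wsum (barrier_shift (w false j) (w true j) lE D eta).
have hX r : hermitian (X r).
  by apply: hermitianD => //; apply: hermitian_sum => j; apply: hermitian_wsum.
suff /(_ s): forall r, {subset r <= s} -> above (mixed_det r) (X r) /\
    forall u, ratio (mixed_det r) u (X r) <= ratio (fun N => \det N) u M.
  by move=> /(_ (fun x => id)) [].
elim=> [_|j r IH rs].
  rewrite /X big_nil addr0; split => //=.
  apply: (garding stable_det hM (hermitian_wsum lE) pE) => x x0.
  rewrite /M -scalerDl -rmorphD; apply: lt0r_neq0; apply: posdef_det.
    by apply: hermitianZ; apply: hermitian_wsum.
  by apply: posdef_scale => //; rewrite ltr_wpDr.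
have [aX rX] := IH (fun x xr => rs x (mem_behead (s := j :: r) xr)).
have XE : X (j :: r) = X r + wsum (barrier_shift (w false j) (w true j) lE D eta).
  by rewrite /X big_cons [_ + \sum_(_ <- _) _]addrC addrA.
have rj b : ratio (mixed_det r) (w b j) (X r) <= 2 - D^-1.
  apply: le_trans (rX _) _; apply: (@le_trans _ _ (1 + c / t)); last by lra.
  apply: ratio_det_le => // [|y]; first by rewrite divr_ge0 // ltW.
  rewrite /M qformZ re_mulr mulrA divfK ?gt_eqF // wc //.
  by apply: rs; rewrite mem_head.
have rr : ratio (mixed_det r) (w false j) (X r) + ratio (mixed_det r) (w true j) (X r)
    <= 2 * (2 - D^-1) by rewrite mulr_natl mulr2n; apply: lerD.
have [aX' rX'] := barrier_step (stable_mixed_det r) lE0 pE D0 e0 (hX r) aX rr.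
rewrite XE; split => //= u; exact: le_trans (rX' u) (rX u).
Qed.
End MixedDeterminant.
End Fixed.
End Matrices.

(** * Splitting a finite frame into two halves *)

Section Halving.
Local Open Scope complex_scope.
Context {R : rcfType}.
Local Notation C := R[i].
Local Notation re := (@complex.Re R).
Local Notation cj := (@conjc R).

Lemma dotc_col_mxl m n (v : 'cV[C]_m) (y1 : 'cV[C]_m) (y2 : 'cV[C]_n) :
  dotc (col_mx v 0) (col_mx y1 y2) = dotc v y1.
Proof.
by rewrite /dotc /adjmx map_col_mx map_mx0 tr_col_mx trmx0 mul_row_col mul0mx addr0.
Qed.

Lemma dotc_col_mxr m n (v : 'cV[C]_n) (y1 : 'cV[C]_m) (y2 : 'cV[C]_n) :
  dotc (col_mx 0 v) (col_mx y1 y2) = dotc v y2.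
Proof.
by rewrite /dotc /adjmx map_col_mx map_mx0 tr_col_mx trmx0 mul_row_col mul0mx add0r.
Qed.

Lemma dotc0r n (v : 'cV[C]_n) : dotc v 0 = 0.
Proof. by rewrite /dotc mulmx0 mxE. Qed.

Lemma re_qform_rank1_sum n (I : Type) (r : seq I) (v : I -> 'cV[C]_n) y :
  re (qform (\sum_(i <- r) rank1 (v i)) y) = \sum_(i <- r) sqmod (dotc (v i) y).
Proof.
by rewrite qform_sum re_sum; apply: eq_bigr => i _; rewrite qform_rank1.
Qed.

(** The construction in dimension n + n makes a single upper bound control
both halves: the diagonal blocks of the chosen sum are the frame operators of
the two subfamilies. *)
Theorem halving_complex n (J : eqType) (v : J -> 'cV[C]_n) (s : seq J) (tau : R) :
  uniq s -> 0 < tau -> tau <= 1 ->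
  (forall y, y != 0 -> 0 < \sum_(j <- s) sqmod (dotc (v j) y)) ->
  (forall j y, j \in s ->
     sqmod (dotc (v j) y) <= tau ^+ 2 * \sum_(i <- s) sqmod (dotc (v i) y)) ->
  exists b : J -> bool, forall (c : bool) y,
    \sum_(j <- s | b j == c) sqmod (dotc (v j) y) <=
      (1 + 7 * tau) / 2 * \sum_(j <- s) sqmod (dotc (v j) y).
Proof.
move=> us tau0 tau1 posv smallv.
pose w (b : bool) j : 'cV[C]_(n + n) := if b then col_mx 0 (v j) else col_mx (v j) 0.
pose lE := [seq (1 : R, w false j) | j <- s] ++ [seq (1 : R, w true j) | j <- s].
have lE0 : nonneg_weights lE.
  by rewrite /nonneg_weights /lE all_cat !all_map; apply/andP; split; apply/allP => j _ /=; rewrite ler01.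
have wE : wsum lE = \sum_(j <- s) (rank1 (w false j) + rank1 (w true j)).
  rewrite wsum_cat /wsum !big_map big_split /=.
  by congr (_ + _); apply: eq_bigr => j _; rewrite scale1r.
pose Q y := \sum_(j <- s) sqmod (dotc (v j) y).
have Q0 y : 0 <= Q y by apply: sumr_ge0 => j _; apply: sqmod_ge0.
have qE y1 y2 : re (qform (wsum lE) (col_mx y1 y2)) = Q y1 + Q y2.
  rewrite wE big_split qformD reD !re_qform_rank1_sum.
  congr (_ + _); apply: eq_bigr => j _; first by rewrite dotc_col_mxl.
  by rewrite dotc_col_mxr.
have pE : posdef (wsum lE).
  move=> y y0; rewrite -[y]vsubmxK qE.
  have [u0|u0] := eqVneq (usubmx y) 0; last by rewrite ltr_pwDl // posv.
  rewrite ltr_wpDl // posv //; apply: contraNneq y0 => d0.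
  by rewrite -[y]vsubmxK u0 d0 col_mx0.
pose D := 1 + tau; pose t := tau * (1 + tau).
pose m : R := (size s)%:R.
have m0 : 0 <= m by rewrite ler0n.
(* eta is so small that all the extra shifts together are at most tau times wsum lE *)
pose eta := tau / ((1 + tau) * (m + 1)).
have D0 : 0 < D by rewrite /D; lra.
have t0 : 0 < t by rewrite mulr_gt0.
have m1 : 0 < m + 1 by lra.
have eta0 : 0 < eta by rewrite divr_gt0 // mulr_gt0.
have wsmall b j y : j \in s ->
    sqmod (dotc (w b j) y) <= tau ^+ 2 * re (qform (wsum lE) y).
  move=> js; rewrite -[y]vsubmxK qE; case: b; rewrite /w ?dotc_col_mxr ?dotc_col_mxl.
    by apply: le_trans (smallv _ _ js) _; rewrite ler_pM2l ?exprn_gt0 // lerDr.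
  by apply: le_trans (smallv _ _ js) _; rewrite ler_pM2l ?exprn_gt0 // lerDl.
(* t and D are chosen to make this an equality *)
have ct : tau ^+ 2 / t <= 1 - D^-1.
  by rewrite le_eqVlt; apply/orP; left; apply/eqP; rewrite /t /D; field; rewrite !gt_eqF.
have t20 : 0 <= tau ^+ 2 by exact: sqr_ge0.
have aX := mixed_det_barrier lE0 pE t20 t0 D0 eta0 ct wsmall.
pose k := t + D / 2 + m * (D * eta).
have XE : t%:C *: wsum lE + \sum_(j <- s) wsum (barrier_shift (w false j) (w true j) lE D eta)
    = k%:C *: wsum lE.
  under eq_bigr => j _.
    rewrite /barrier_shift !wsum_cons wsum_rescale /= addrA -scalerDr; over.
  rewrite big_split /= -scaler_sumr -wE.
  have -> : \sum_(i <- s) ((D * eta)%:C *: wsum lE) = (m * (D * eta))%:C *: wsum lE.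
    rewrite big_const_seq count_predT iter_addr_0 -scaler_nat scalerA.
    have mC : m%:C = (size s)%:R :> C by exact: (rmorph_nat (real_complex R)).
    by rewrite -mC -rmorphM.
  by rewrite -!scalerDl -!rmorphD addrA.
rewrite XE in aX.
have hX : hermitian (k%:C *: wsum lE) by apply: hermitianZ; apply: hermitian_wsum.
have [b ab] := mixed_det_selection lE0 pE us hX aX.
have hZ : hermitian (k%:C *: wsum lE - \sum_(j <- s) rank1 (w (b j) j)).
  by apply: hermitianD => //; apply: hermitianN; apply: hermitian_sum => j; apply: hermitian_rank1.
have psd := above_det_psd hZ ab.
have kle : k <= (1 + 7 * tau) / 2.
  have : m * (D * eta) <= tau.
    rewrite /eta -/D (_ : _ * _ = tau * (m / (m + 1))); last first.
      by field; rewrite !gt_eqF.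
    by rewrite ger_pMr // ler_pdivrMr // mul1r lerDl.
  rewrite /k /t /D; have : tau * tau <= tau by rewrite ger_pMr.
  lra.
exists b => c y.
have := psd (if c then col_mx 0 y else col_mx y 0).
rewrite qformD qformN qformZ reD re_mulr.
rewrite (_ : re (- _) = - re (qform (\sum_(j <- s) rank1 (w (b j) j))
  (if c then col_mx 0 y else col_mx y 0))); last by case: (qform _ _).
rewrite subr_ge0 re_qform_rank1_sum.
have -> : re (qform (wsum lE) (if c then col_mx 0 y else col_mx y 0)) = Q y.
  case: c; rewrite qE; rewrite [Q 0]big1 ?addr0 ?add0r // => j _;
  by rewrite dotc0r /sqmod /= expr0n addr0.
move=> H; apply: le_trans (_ : k * Q y <= _); last exact: ler_wpM2r.
apply: le_trans H; rewrite big_mkcond /=; apply: ler_sum => j _.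
rewrite /w; case: (b j) c => -[] /=;
  by rewrite ?dotc_col_mxr ?dotc_col_mxl ?sqmod_ge0.
Qed.
End Halving.

(** * Iterated halving *)

Section Iterate.
Context {R : rcfType} (Y : Type) (J : eqType) (N : Y -> R) (q : J -> Y -> R).
Implicit Types s : seq J.

Definition fsum s y := \sum_(j <- s) q j y.

(** The halving property, stated for abstract families so that it applies to
real and to complex spaces. *)
Definition halvable := forall s (tau : R), uniq s -> 0 < tau -> tau <= 1 ->
  (forall y, 0 < N y -> 0 < fsum s y) ->
  (forall j y, j \in s -> q j y <= tau ^+ 2 * fsum s y) ->
  exists b : J -> bool, forall (c : bool) y,
    fsum [seq j <- s | b j == c] y <= (1 + 7 * tau) / 2 * fsum s y.

Variable kappa : R.
Hypotheses (k0 : 0 < kappa) (N0 : forall y, 0 <= N y) (hq : halvable).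
Hypothesis qN : forall j y, q j y <= kappa ^+ 2 * N y.

(** The error 60 kappa sqrt a is proportional to kappa / sqrt a relative to a;
the constant is chosen so that one halving step reproduces it at a / 2. *)
Definition window s (a : R) := forall y,
  (a - 60 * kappa * Num.sqrt a) * N y <= fsum s y <=
  (a + 60 * kappa * Num.sqrt a) * N y.

(** With tau = 2 kappa / z and z = sqrt a, the absolute error grows from 60
kappa z before halving to at most 81 kappa z / 2 after it, and 40.5 z <= 60 z'
since z' = sqrt (a / 2) >= 27/40 z. *)
Lemma window_halve s a : uniq s -> 0 < a -> 120 * kappa <= Num.sqrt a ->
  window s a ->
  exists b : J -> bool, forall c, window [seq j <- s | b j == c] (a / 2).
Proof.
move=> us a0 ka win; set z := Num.sqrt a in ka.
have z0 : 0 < z by rewrite sqrtr_gt0.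
have zE : a = z ^+ 2 by rewrite sqr_sqrtr // ltW.
pose tau := 2 * kappa / z.
have tz : tau * z = 2 * kappa by rewrite divfK // gt_eqF.
have tau0 : 0 < tau by rewrite divr_gt0 // mulr_gt0.
have tau60 : 60 * tau <= 1 by rewrite -(ler_pM2r z0) -mulrA tz; lra.
have tau1 : tau <= 1 by lra.
have lo y : a / 2 * N y <= fsum s y.
  have /andP[+ _] := win y; apply: le_trans; apply: ler_wpM2r => //.
  rewrite -/z zE; have : 120 * kappa * z <= z * z by rewrite ler_pM2r.
  by rewrite expr2; lra.
have [b bE] : exists b : J -> bool, forall (c : bool) y,
    fsum [seq j <- s | b j == c] y <= (1 + 7 * tau) / 2 * fsum s y.
  apply: hq => // [y Ny|j y js].
    by apply: lt_le_trans (lo y); rewrite mulr_gt0 // divr_gt0.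
  apply: le_trans (qN j y) _.
  apply: le_trans (ler_wpM2l (sqr_ge0 tau) (lo y)).
  rewrite mulrA; apply: ler_wpM2r => //.
  have -> : tau ^+ 2 * (a / 2) = (tau * z) ^+ 2 / 2 by rewrite zE; field.
  rewrite tz exprMn; have := sqr_ge0 kappa; lra.
exists b => c y.
set z' := Num.sqrt (a / 2).
have z'z : 27 * z <= 40 * z'.
  have zz : z' ^+ 2 = z ^+ 2 / 2 by rewrite sqr_sqrtr ?zE // ltW // divr_gt0 // -zE.
  rewrite -(@ler_pXn2r _ 2) // ?nnegrE ?mulr_ge0 ?sqrtr_ge0 ?ltW //.
  rewrite !exprMn zz; have := sqr_ge0 z; lra.
have part : fsum s y = fsum [seq j <- s | b j == c] y + fsum [seq j <- s | b j == ~~ c] y.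
  rewrite /fsum (bigID (fun j => b j == c)) /= !big_filter; congr (_ + _).
  by apply: eq_bigl => j; case: (b j) c => -[].
have uc := bE c y; have unc := bE (~~ c) y.
have /andP[w1 w2] := win y; rewrite -/z in w1 w2.
have kz : kappa * kappa <= kappa * z / 120.
  by rewrite -mulrA ler_pM2l //; lra.
have Ny := N0 y.
apply/andP; split.
  apply: (@le_trans _ _ ((1 - 7 * tau) / 2 * fsum s y)); last by rewrite part in unc *; lra.
  apply: (@le_trans _ _ ((1 - 7 * tau) / 2 * ((a - 60 * kappa * z) * N y))); last first.
    by apply: ler_wpM2l w1; lra.
  rewrite mulrA; apply: ler_wpM2r => //.
  have -> : (1 - 7 * tau) / 2 * (a - 60 * kappa * z) =
     a / 2 - 30 * kappa * z - 7 / 2 * (tau * z) * z + 210 * kappa * (tau * z).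
    by rewrite zE; field.
  rewrite tz; have : 0 <= kappa * kappa by rewrite mulr_ge0 // ltW.
  have : kappa * (27 * z) <= kappa * (40 * z') by rewrite ler_pM2l.
  have : 0 <= kappa * z by rewrite mulr_ge0 // ltW.
  lra.
apply: (le_trans uc).
apply: (@le_trans _ _ ((1 + 7 * tau) / 2 * ((a + 60 * kappa * z) * N y))).
  by apply: ler_wpM2l w2; lra.
rewrite mulrA; apply: ler_wpM2r => //.
have -> : (1 + 7 * tau) / 2 * (a + 60 * kappa * z) =
   a / 2 + 30 * kappa * z + 7 / 2 * (tau * z) * z + 210 * kappa * (tau * z).
  by rewrite zE; field.
rewrite tz.
have : kappa * (27 * z) <= kappa * (40 * z') by rewrite ler_pM2l.
have : 0 <= kappa * z by rewrite mulr_ge0 // ltW.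
lra.
Qed.

Lemma window_iterate m s a : uniq s -> 0 < a ->
  120 * kappa <= Num.sqrt (a / 2 ^+ m) -> window s a ->
  exists col : J -> nat, (forall j, (col j < 2 ^ m)%N) /\
    forall c, (c < 2 ^ m)%N -> window [seq j <- s | col j == c] (a / 2 ^+ m).
Proof.
elim: m s a => [|m IH] s a us a0 ka win.
  exists (fun=> 0%N); split => // -[|//] _; rewrite expr0 divr1.
  by rewrite (eq_filter (a2 := xpredT)) ?filter_predT.
have two0 : 0 < (2 : R) ^+ m by rewrite exprn_gt0.
have two1 : 1 <= (2 : R) ^+ m by rewrite exprn_ege1 // ler1n.
have E : a / 2 ^+ m.+1 = a / 2 / 2 ^+ m by rewrite exprS; field; rewrite gt_eqF.
have ka' : 120 * kappa <= Num.sqrt a.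
  apply: le_trans ka _; rewrite ler_wsqrtr // ler_pdivrMr ?exprn_gt0 //.
  by rewrite ler_peMr ?exprn_ege1 ?ler1n // ltW.
have [b bw] := window_halve us a0 ka' win.
have a20 : 0 < a / 2 by rewrite divr_gt0.
rewrite E in ka.
have ex c : exists col : J -> nat, (forall j, (col j < 2 ^ m)%N) /\
    forall d, (d < 2 ^ m)%N ->
      window [seq j <- [seq j <- s | b j == c] | col j == d] (a / 2 / 2 ^+ m).
  by apply: IH => //; apply: filter_uniq.
have [col0 [lt0 w0]] := ex false; have [col1 [lt1 w1]] := ex true.
pose col j := if b j then (2 ^ m + col1 j)%N else col0 j.
exists col; split=> [j|c cm].
  rewrite /col expnS mul2n -addnn; case: (b j); first by rewrite ltn_add2l.
  by rewrite ltn_addr.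
rewrite E; have [cl|cg] := ltnP c (2 ^ m).
  have := w0 c cl; rewrite -filter_predI; congr (window _ _); apply: eq_filter => j /=.
  rewrite /col; case: (b j) => /=; rewrite ?andbT ?andbF //.
  by apply/esym/negbTE; rewrite neq_ltn; apply/orP; right; rewrite ltn_addr.
have c' : (c - 2 ^ m < 2 ^ m)%N by rewrite ltn_subLR // addnn -mul2n -expnS.
have := w1 _ c'; rewrite -filter_predI; congr (window _ _); apply: eq_filter => j /=.
rewrite /col; case: (b j) => /=; rewrite ?andbT ?andbF.
  by rewrite -(eqn_add2l (2 ^ m)) subnKC.
by apply/esym/negbTE; rewrite neq_ltn; apply/orP; left; apply: leq_trans cg.
Qed.
End Iterate.

(** * Forms over real or complex scalars *)

Section Form.
Local Open Scope complex_scope.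
Context {R : realType}.
Local Notation C := R[i].
Local Notation re := (@complex.Re R).
Local Notation cj := (@conjc R).
Variables (F : numFieldType) (theta : F -> F) (iota : {rmorphism F -> C}).
Hypothesis iota_theta : forall z, iota (theta z) = cj (iota z).
Hypothesis iota_gt0 : forall z, 0 < z -> 0 < iota z.
Hypothesis iota_span :
  ((forall c : C, exists a b, c = iota a + 'i * iota b) /\
   (forall a b, sqmod (iota a + 'i * iota b) = sqmod (iota a) + sqmod (iota b)))
  \/ (forall c, exists a, c = iota a).
Variables (H : vectType F) (form : {dot H for theta}).

(** The form with values transported to the complex numbers by [iota], which
is the embedding of the reals or the identity. *)
Definition gform (u v : H) : C := iota (form u v).
Definition sqnorm (u : H) : R := re (gform u u).

Lemma gformDl u v w : gform (u + v) w = gform u w + gform v w.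
Proof. by rewrite /gform linearDl rmorphD. Qed.

Lemma gformZl a u w : gform (a *: u) w = iota a * gform u w.
Proof. by rewrite /gform linearZl_LR rmorphM. Qed.

Lemma gformC u v : gform u v = cj (gform v u).
Proof.
by rewrite /gform -iota_theta; have := hermitian_subproof (s := form) u v; rewrite expr0 mul1r => ->.
Qed.
Lemma gformDr u v w : gform w (u + v) = gform w u + gform w v.
Proof. by rewrite gformC gformDl rmorphD /= -!gformC. Qed.

Lemma gformZr a u w : gform w (a *: u) = cj (iota a) * gform w u.
Proof. by rewrite gformC gformZl rmorphM /= -gformC. Qed.

Lemma gform0l w : gform 0 w = 0.
Proof. by rewrite -(scale0r (0 : H)) gformZl rmorph0 mul0r. Qed.

Lemma gform0r w : gform w 0 = 0.
Proof. by rewrite gformC gform0l rmorph0. Qed.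

Lemma gform_suml I (r : seq I) (a : I -> F) (b : I -> H) w :
  gform (\sum_(i <- r) a i *: b i) w = \sum_(i <- r) iota (a i) * gform (b i) w.
Proof.
by elim: r => [|i r IH]; rewrite ?big_nil ?gform0l // !big_cons gformDl gformZl IH.
Qed.

Lemma gform_sumr I (r : seq I) (a : I -> F) (b : I -> H) w :
  gform w (\sum_(i <- r) a i *: b i) = \sum_(i <- r) cj (iota (a i)) * gform w (b i).
Proof.
by elim: r => [|i r IH]; rewrite ?big_nil ?gform0r // !big_cons gformDr gformZr IH.
Qed.

Lemma gform_real u : gform u u = (sqnorm u)%:C.
Proof.
have := gformC u u; rewrite /sqnorm; case: (gform u u) => a b /= [] /eqP.
by rewrite -subr_eq0 opprK -mulr2n mulrn_eq0 /= => /eqP ->.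
Qed.

Lemma sqnorm_gt0 u : u != 0 -> 0 < sqnorm u.
Proof.
move=> u0; have := iota_gt0 (neq0_dnorm_gt0 (s := form) u u0).
by rewrite -[iota _]/(gform u u) gform_real ltcR.
Qed.

Lemma sqnorm0 : sqnorm 0 = 0.
Proof. by rewrite /sqnorm gform0l. Qed.

Lemma sqnorm_ge0 u : 0 <= sqnorm u.
Proof. by have [->|/sqnorm_gt0/ltW //] := eqVneq u 0; rewrite sqnorm0. Qed.

Lemma cauchy_schwarz y x : sqmod (gform y x) <= sqnorm x * sqnorm y.
Proof.
have [->|x0] := eqVneq x 0; first by rewrite gform0r sqnorm0 mul0r /sqmod /= expr0n addr0.
have bp := sqnorm_gt0 x0.
have : (0 : R)%:C <= (sqnorm (form x x *: y + (- form y x) *: x))%:C.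
  by rewrite lecR sqnorm_ge0.
rewrite -gform_real !(gformDl, gformDr, gformZl, gformZr) rmorphN.
rewrite -[iota (form x x)]/(gform x x) -[iota (form y x)]/(gform y x).
rewrite !gform_real (gformC x y) rmorphN conjc_real.
set c := gform y x.
set E := (X in _ <= X -> _).
have -> : E = (sqnorm x)%:C * ((sqnorm x)%:C * (sqnorm y)%:C - cj c * c).
  by rewrite /E ?rmorphN ?conjcK; ring.
rewrite conjM_sqmod -!rmorphM -rmorphB -rmorphM lecR.
by rewrite pmulr_rge0 // subr_ge0.
Qed.

Lemma sqmodM (z w : C) : sqmod (z * w) = sqmod z * sqmod w.
Proof. by case: z w => a b [c d]; rewrite /sqmod /=; ring. Qed.

Lemma sqmodD (z w : C) : sqmod (z + w) <= 2 * (sqmod z + sqmod w).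
Proof.
rewrite -subr_ge0.
have -> : 2 * (sqmod z + sqmod w) - sqmod (z + w) = sqmod (z - w).
  by case: z w => a b [c d]; rewrite /sqmod /=; ring.
exact: sqmod_ge0.
Qed.

Lemma sqmod_sum (n : nat) (z : 'I_n -> C) :
  sqmod (\sum_i z i) <= 2 ^+ n * \sum_i sqmod (z i).
Proof.
elim: n z => [|n IH] z; first by rewrite !big_ord0 /sqmod /= expr0n addr0 mulr0.
rewrite !big_ord_recl; apply: le_trans (sqmodD _ _) _.
rewrite exprS -mulrA ler_pM2l // mulrDr; apply: lerD; last exact: IH.
by rewrite ler_peMl ?sqmod_ge0 // exprn_ege1 // ler1n.
Qed.

Local Notation n := (\dim {:H}).
Local Notation basis := (vbasis {:H}).

Lemma basisE (y : H) : y = \sum_(i < n) coord basis i y *: basis`_i.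
Proof. by apply: coord_vbasis; apply: memvf. Qed.

(** The Gram matrix of a basis is invertible, and the columns of its inverse
give the vectors that represent the coordinates. *)
Lemma riesz_coord (i : 'I_n) : exists g : H, forall y, form y g = coord basis i y.
Proof.
pose G : 'M[F]_n := \matrix_(k, l) form basis`_k basis`_l.
have uG : G \in unitmx.
  rewrite -row_free_unit -kermx_eq0; apply/negPn/negP => /rowV0Pn[v].
  move=> /sub_kermxP vG v0.
  pose u := \sum_(k < n) v 0 k *: basis`_k.
  have ub (l : 'I_n) : gform u basis`_l = 0.
    have := congr1 (fun M : 'rV_n => iota (M 0 l)) vG.
    rewrite !mxE rmorph0 rmorph_sum gform_suml => E.
    by rewrite -[RHS]E; apply: eq_bigr => k _; rewrite rmorphM mxE.
  have u0 : u = 0.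
    apply: contraTeq isT => /sqnorm_gt0; rewrite /sqnorm {2}/u gform_sumr.
    by rewrite big1 ?ltxx // => k _; rewrite ub mulr0.
  have /freeP/(_ (fun k => v 0 k) u0) v00 := basis_free (vbasisP {:H}).
  by case/negP: v0; apply/eqP/rowP => k; rewrite v00 mxE.
exists (\sum_(l < n) theta (invmx G l i) *: basis`_l) => y.
apply: (fmorph_inj iota); rewrite -[LHS]/(gform _ _) gform_sumr.
have -> : \sum_(l < n) cj (iota (theta (invmx G l i))) * gform y basis`_l =
    \sum_(l < n) iota (invmx G l i) * gform y basis`_l.
  by apply: eq_bigr => l _; rewrite iota_theta conjcK.
have -> : \sum_(l < n) iota (invmx G l i) * gform y basis`_l =
   iota (\sum_(k < n) coord basis k y * \sum_(l < n) G k l * invmx G l i).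
  rewrite rmorph_sum {1}[y]basisE; under eq_bigr do rewrite gform_suml mulr_sumr.
  rewrite exchange_big /=; apply: eq_bigr => k _.
  rewrite rmorphM rmorph_sum mulr_sumr; apply: eq_bigr => l _.
  by rewrite rmorphM mxE /gform; ring.
congr (iota _); rewrite (bigD1 i) //= [X in _ + X]big1 ?addr0.
  have := congr1 (fun M : 'M_n => M i i) (mulmxV uG).
  by rewrite !mxE eqxx => ->; rewrite mulr1.
move=> k ki; have := congr1 (fun M : 'M_n => M k i) (mulmxV uG).
by rewrite !mxE (negPf ki) => ->; rewrite mulr0.
Qed.

Lemma coord_bound : exists2 c : R, 0 <= c &
  forall (i : 'I_n) y, sqmod (iota (coord basis i y)) <= c * sqnorm y.
Proof.
have ex (i : 'I_n) : exists g : H, forall y, form y g = coord basis i y.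
  exact: riesz_coord.
have [g gE] := choice ex.
(* one constant for all coordinates: the sum of the individual ones *)
exists (\sum_i sqnorm (g i)) => [|i y]; first by apply: sumr_ge0 => i _; apply: sqnorm_ge0.
rewrite -gE; apply: le_trans (cauchy_schwarz y (g i)) _.
rewrite ler_wpM2r ?sqnorm_ge0 // (bigD1 i) //= lerDl.
by apply: sumr_ge0 => k _; apply: sqnorm_ge0.
Qed.

(** This bounds a whole family of functions of y by finitely many of their
values, which makes tails uniform in y. *)
Lemma form_expansion : exists2 c : R, 0 < c & forall y x,
  sqmod (gform y x) <= c * sqnorm y * \sum_(i < n) sqmod (gform basis`_i x).
Proof.
have [c c0 cE] := coord_bound.
exists (2 ^+ n * (c + 1)) => [|y x]; first by rewrite mulr_gt0 ?exprn_gt0 //; lra.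
rewrite {1}[y]basisE gform_suml; apply: le_trans (sqmod_sum _) _.
rewrite -!mulrA ler_pM2l ?exprn_gt0 // !mulr_sumr; apply: ler_sum => i _.
rewrite sqmodM mulrA ler_wpM2r ?sqmod_ge0 //; apply: le_trans (cE i y) _.
by rewrite ler_wpM2r ?sqnorm_ge0 // lerDl.
Qed.

(** Coordinates in any basis identify the functions y |-> [form y (x j)] with
[dotc (v j)].  A complex coordinate vector corresponds to one vector of H, or
in the real case to two, its real and imaginary part, and the square moduli
add up. *)
Lemma halvable_form (J : eqType) (x : J -> H) :
  halvable sqnorm (fun j y => sqmod (gform y (x j))).
Proof.
move=> s tau us t0 t1 pos small.
pose v j : 'cV[C]_n := \col_i cj (gform basis`_i (x j)).
have vE j (z : 'cV[C]_n) : dotc (v j) z = \sum_(i < n) gform basis`_i (x j) * z i 0.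
  by rewrite /dotc mxE; apply: eq_bigr => i _; rewrite !mxE conjcK.
pose vec (a : 'I_n -> F) := \sum_(i < n) a i *: basis`_i.
have vecE j a : gform (vec a) (x j) = \sum_(i < n) gform basis`_i (x j) * iota (a i).
  by rewrite gform_suml; apply: eq_bigr => i _; rewrite mulrC.
have dec (z : 'cV[C]_n) : exists y1 y2, (forall j, sqmod (dotc (v j) z) =
    sqmod (gform y1 (x j)) + sqmod (gform y2 (x j))) /\ (z != 0 -> y1 != 0 \/ y2 != 0).
  have vec_neq0 a : vec a = 0 -> forall i, a i = 0.
    by move=> a0; have /freeP/(_ a a0) := basis_free (vbasisP {:H}).
  case: iota_span => [[span sq]|surj].
    have /choice[a aE] : forall i, exists a, exists b, z i 0 = iota a + 'i * iota b.
      by move=> i; apply: span.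
    have [b bE] := choice aE.
    exists (vec a), (vec b); split=> [j|z0].
      have -> : sqmod (gform (vec a) (x j)) + sqmod (gform (vec b) (x j)) =
          sqmod (gform (vec a) (x j) + 'i * gform (vec b) (x j)) by rewrite sq.
      rewrite vE !vecE mulr_sumr -big_split /=; congr sqmod.
      by apply: eq_bigr => i _; rewrite bE; ring.
    have [a0|] := eqVneq (vec a) 0; [right|by left].
    apply: contraNneq z0 => b0; apply/eqP/colP => i.
    by rewrite bE (vec_neq0 _ a0) (vec_neq0 _ b0) rmorph0 mulr0 addr0 mxE.
  have [a aE] := choice (fun i => surj (z i 0)).
  exists (vec a), 0; split=> [j|z0].
    rewrite gform0l /sqmod /= expr0n !addr0 -/(sqmod _) -/(sqmod _) vE vecE.
    by congr sqmod; apply: eq_bigr => i _; rewrite aE.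
  left; apply: contraNneq z0 => a0; apply/eqP/colP => i.
  by rewrite aE (vec_neq0 _ a0) rmorph0 mxE.
pose q j y := sqmod (gform y (x j)).
have sumdec z y1 y2 (P : pred J) : (forall j, sqmod (dotc (v j) z) = q j y1 + q j y2) ->
    \sum_(j <- s | P j) sqmod (dotc (v j) z) =
    \sum_(j <- s | P j) q j y1 + \sum_(j <- s | P j) q j y2.
  by move=> E; rewrite -big_split; apply: eq_bigr => j _; rewrite E.
have q0 y : 0 <= fsum q s y by apply: sumr_ge0 => j _; apply: sqmod_ge0.
have [|j z js|b bE] := halving_complex us t0 t1 (v := v).
- move=> z z0; have [y1 [y2 [E /(_ z0) yy]]] := dec z.
  rewrite (sumdec _ _ _ _ E) -!/(fsum q s _); case: yy => y0.
    by rewrite ltr_pwDl // pos // sqnorm_gt0.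
  by rewrite ltr_wpDl // pos // sqnorm_gt0.
- have [y1 [y2 [E _]]] := dec z.
  rewrite (sumdec _ _ _ _ E) E mulrDr; apply: lerD; exact: small.
exists b => c y.
pose z : 'cV[C]_n := \col_i iota (coord basis i y).
have zE j : sqmod (dotc (v j) z) = q j y.
  rewrite vE /q {1}[y]basisE vecE; congr sqmod.
  by apply: eq_bigr => i _; rewrite mxE.
have E (P : pred J) : \sum_(j <- s | P j) sqmod (dotc (v j) z) = \sum_(j <- s | P j) q j y.
  by apply: eq_bigr.
by have := bE c z; rewrite !E /fsum big_filter.
Qed.

End Form.

(** * Frames as families of quadratic functions *)

Section ExtendedSums.
Context {R : realType} {J : choiceType}.
Implicit Types (B : set J) (a : J -> R) (s t : seq J).

Lemma le_esum_seq B a s : (forall j, 0 <= a j) -> uniq s ->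
  (forall j, j \in s -> B j) ->
  ((\sum_(j <- s) a j)%:E <= \esum_(j in B) (a j)%:E)%E.
Proof.
move=> a0 us sB; apply: esum_ge; exists [set` s]; last first.
  by rewrite -(fsbig_seq _ _ us) sumEFin.
by split; [exact: finite_seq|move=> j /= /sB].
Qed.

Lemma esum_le_seq B a (u : R) : (forall s, uniq s ->
    (forall j, j \in s -> B j) -> \sum_(j <- s) a j <= u) ->
  (\esum_(j in B) (a j)%:E <= u%:E)%E.
Proof.
move=> H; apply: ge_ereal_sup => _ [A [finA AB] <-].
rewrite fsbig_finite // sumEFin lee_fin; apply: H; first exact: fset_uniq.
by move=> j; rewrite in_fset_set // => /set_mem/AB.
Qed.

Lemma esum_approx a (v e : R) : \esum_(j in [set: J]) (a j)%:E = v%:E -> 0 < e ->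
  exists s, uniq s /\ v - e < \sum_(j <- s) a j.
Proof.
move=> av e0; apply: contrapT => /forallNP H.
have : (v%:E <= (v - e)%:E)%E.
  rewrite -av; apply: esum_le_seq => s us _; rewrite leNgt; apply/negP => h.
  exact: (H s).
by rewrite lee_fin; lra.
Qed.

Lemma sum_subseq_le a s t : (forall j, 0 <= a j) -> uniq s -> uniq t ->
  {subset s <= t} -> \sum_(j <- s) a j <= \sum_(j <- t) a j.
Proof.
move=> a0 us ut st; rewrite [leRHS](bigID (mem s)) /= -[X in _ <= X + _]big_filter.
have prm : perm_eq [seq j <- t | j \in s] s.
  apply: uniq_perm; rewrite ?filter_uniq // => j; rewrite mem_filter.
  by case: (boolP (j \in s)) => // /st ->.
by rewrite (perm_big _ prm) lerDl; apply: sumr_ge0.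
Qed.
End ExtendedSums.

Lemma dyadic_level (R : realType) (K theta : R) : 0 < theta -> theta <= K ->
  exists m, theta <= K / 2 ^+ m /\ K / 2 ^+ m < 2 * theta.
Proof.
move=> t0 tK; have p0 m : 0 < (2 : R) ^+ m by rewrite exprn_gt0.
have ex : exists m, K / 2 ^+ m < 2 * theta.
  have K0 : 0 <= K / (2 * theta) by rewrite divr_ge0 ?mulr_ge0; lra.
  exists (Num.bound (K / (2 * theta))); rewrite ltr_pdivrMr // mulrC -ltr_pdivrMr ?mulr_gt0 //.
  have := archi_boundP K0; move=> /lt_le_trans; apply.
  by rewrite -natrX ler_nat ltnW // ltn_expl.
case: (ex_minnP ex) => -[|m] Km min; first by exists 0%N; rewrite expr0 divr1 in Km *.
exists m.+1; split => //; rewrite leNgt; apply/negP => h.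
have : K / 2 ^+ m < 2 * theta.
  have -> : K / 2 ^+ m = 2 * (K / 2 ^+ m.+1) by rewrite exprS; field; rewrite gt_eqF.
  by rewrite ltr_pM2l.
by move=> /min; rewrite ltnn.
Qed.

Definition tail_small (R : realType) (Y : Type) (J : choiceType) (N : Y -> R)
    (q : J -> Y -> R) := forall e, 0 < e -> exists s : seq J, uniq s /\
  forall y A, uniq A -> (forall j, j \in A -> j \notin s) -> fsum q A y <= e * N y.

Section AbstractFrames.
Context {R : realType} (Y : Type) (J : choiceType) (N : Y -> R) (q : J -> Y -> R).
Variables (K kappa : R).
Hypotheses (k0 : 0 < kappa) (K1 : 1 < K).
Hypotheses (N0 : forall y, 0 <= N y) (q0 : forall j y, 0 <= q j y).
Hypothesis hq : halvable N q.
Hypothesis qN : forall j y, q j y <= kappa ^+ 2 * N y.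
Hypothesis tight : forall y, \esum_(j in [set: J]) (q j y)%:E = (K * N y)%:E.
Hypothesis tail : tail_small N q.

Definition frame_on (B : set J) (a b : R) := [/\ 0 < a, 0 < b & forall y,
  ((a * N y)%:E <= \esum_(j in B) (q j y)%:E <= (b * N y)%:E)%E].

(** A finite part of the family carries almost the whole tight frame, hence
lies in the initial window, and is halved m times. *)
Lemma frame_pieces m : 120 * kappa <= Num.sqrt (K / 2 ^+ m) ->
  exists (s : seq J) (col : J -> nat), [/\ uniq s, (forall j, (col j < 2 ^ m)%N),
    (forall c, (c < 2 ^ m)%N -> window N q kappa [seq j <- s | col j == c] (K / 2 ^+ m)) &
    forall y A, uniq A -> (forall j, j \in A -> j \notin s) -> fsum q A y <= N y].
Proof.
move=> km; have K0 : 0 < K by exact: lt_trans K1.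
(* the bound 60 kappa sqrt K places the finite part in the window; the bound 1 is for the tail *)
pose e := Num.min 1 (60 * kappa * Num.sqrt K).
have ke : 0 < 60 * kappa * Num.sqrt K by rewrite !mulr_gt0 // sqrtr_gt0.
have e0 : 0 < e by rewrite lt_min ltr01.
have e1 : e <= 1 by rewrite ge_min lexx.
have e2 : e <= 60 * kappa * Num.sqrt K by rewrite ge_min lexx orbT.
have [s [us sT]] := tail e0.
have ws : window N q kappa s K.
  move=> y; apply/andP; split; last first.
    have : ((fsum q s y)%:E <= (K * N y)%:E)%E by rewrite -tight; apply: le_esum_seq.
    rewrite lee_fin => /le_trans; apply; rewrite ler_wpM2r //; lra.
  apply: (@le_trans _ _ ((K - e) * N y)); first by rewrite ler_wpM2r //; lra.
  apply/ler_addgt0Pr => d d0; have [t [ut tE]] := esum_approx (tight y) d0.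
  have : \sum_(j <- t) q j y <= fsum q s y + e * N y.
    rewrite (bigID (mem s)) /= -[X in X + _ <= _]big_filter -[X in _ + X <= _]big_filter; apply: lerD.
      apply: sum_subseq_le => //; first exact: filter_uniq.
      by move=> j; rewrite mem_filter => /andP[].
    apply: sT; first exact: filter_uniq.
    by move=> j; rewrite mem_filter => /andP[].
  by move: tE; rewrite mulrBl; lra.
have [col [cl cw]] := window_iterate k0 N0 hq qN us K0 km ws.
exists s, col; split => // y A uA As; apply: le_trans (sT y A uA As) _.
by rewrite ler_piMl.
Qed.

Lemma frame_setT a b : 0 < a -> 0 < b -> a <= K -> K <= b -> frame_on setT a b.
Proof.
move=> a0 b0 aK Kb; split => // y; rewrite tight !lee_fin.
by apply/andP; split; rewrite ler_wpM2r.
Qed.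

(** Halving stops at a level in [120^2, 2 * 120^2), where the error is at most
half of the level.  The tail, of size at most 1, joins the piece number 0.  If
the frame bound is below 120^2, or if there is no nonzero vector, one piece
does. *)
Lemma partition_into_frames : kappa = 1 ->
  exists (D : set nat) (F : nat -> set J), partition D F [set: J] /\
    forall i, D i -> frame_on (F i) 1 (4 * 120 ^+ 2).
Proof.
move=> kE; have gK1 := K1.
have L2 : 2 <= 120 ^+ 2 :> R by rewrite expr2; lra.
have [[j0 _]|/forallNP noJ] := pselect (exists j : J, True); last first.
  have J0 : [set: J] = set0 by apply/seteqP; split => // j _; case: (noJ j).
  exists set0, (fun=> setT); split; last by move=> i [].
  split; first by rewrite /cover bigcup_set0 J0.
    by move=> i k [].
  by move=> i [].
have one : frame_on setT 1 (4 * 120 ^+ 2) ->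
    exists (D : set nat) (F : nat -> set J), partition D F [set: J] /\
    forall i, D i -> frame_on (F i) 1 (4 * 120 ^+ 2).
  move=> fr; exists [set 0%N], (fun=> setT); split => //; split.
  - by apply/seteqP; split => // j _; exists 0%N.
  - by move=> i j /= -> ->.
  - by move=> i _; exists j0.
have [K2|K2] := ltrP K (120 ^+ 2).
  by apply: one; apply: frame_setT; lra.
have [[y0 Ny0]|/forallNP noY] := pselect (exists y, 0 < N y); last first.
  apply: one; split; [lra|lra|] => y.
  have -> : N y = 0 by apply/eqP; rewrite eq_le N0 andbT leNgt; apply/negP/noY.
  rewrite !mulr0 esum1 ?lexx // => j _; congr EFin; apply/eqP.
  rewrite eq_le q0 andbT; apply: le_trans (qN j y) _.
  rewrite (_ : N y = 0) ?mulr0 //.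
  by apply/eqP; rewrite eq_le N0 andbT leNgt; apply/negP/noY.
have [m [m1 m2]] := dyadic_level (exprn_gt0 2 (ltr0n _ 120) : 0 < 120 ^+ 2 :> R) K2.
set a := K / 2 ^+ m in m1 m2.
have sa : 120 <= Num.sqrt a.
  by rewrite -(@ler_pXn2r _ 2) ?nnegrE ?sqrtr_ge0 // sqr_sqrtr //; lra.
have [|s [col [us cl cw sT]]] := @frame_pieces m; first by rewrite kE mulr1.
have a2 : 60 * Num.sqrt a <= a / 2.
  have sE : a = Num.sqrt a * Num.sqrt a by rewrite -expr2 sqr_sqrtr //; lra.
  have : 120 * Num.sqrt a <= Num.sqrt a * Num.sqrt a by rewrite ler_wpM2r ?sqrtr_ge0.
  lra.
have win c y : (c < 2 ^ m)%N ->
    a / 2 * N y <= fsum q [seq j <- s | col j == c] y <= 3 / 2 * a * N y.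
  move=> cm; have := cw c cm y; rewrite kE mulr1 => /andP[w1 w2]; apply/andP; split.
    by apply: le_trans w1; rewrite ler_wpM2r // -/a; lra.
  by apply: le_trans w2 _; rewrite ler_wpM2r // -/a; lra.
pose F c : set J := [set j | (if j \in s then col j else 0%N) = c].
exists [set c | (c < 2 ^ m)%N], F; split.
  split.
  - apply/seteqP; split => // j _; exists (if j \in s then col j else 0%N) => //=.
    by case: ifP => _; rewrite ?cl ?expn_gt0.
  - by move=> c d _ _ [j [/= <- <-]].
  - move=> c cm; have /andP[w _] := win c y0 cm.
    have : 0 < fsum q [seq j <- s | col j == c] y0.
      by apply: lt_le_trans w; rewrite mulr_gt0 //; lra.
    rewrite /fsum; case E : [seq j <- s | col j == c] => [|j r].
      by rewrite big_nil ltxx.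
    move=> _; exists j; have : j \in [seq j <- s | col j == c] by rewrite E mem_head.
    by rewrite mem_filter /F /= => /andP[/eqP <- ->].
move=> c cm; split; [lra|lra|] => y; have /andP[w1 w2] := win c y cm.
apply/andP; split.
  apply: (@le_trans _ _ (fsum q [seq j <- s | col j == c] y)%:E).
    by rewrite lee_fin; apply: le_trans w1; rewrite ler_wpM2r //; lra.
  apply: le_esum_seq => //; first exact: filter_uniq.
  by move=> j; rewrite mem_filter /F /= => /andP[/eqP <- ->].
apply: esum_le_seq => t ut tF.
apply: (@le_trans _ _ (fsum q [seq j <- s | col j == c] y + N y)); last first.
  apply: (@le_trans _ _ (3 / 2 * a * N y + 1 * N y)); first by rewrite mul1r lerD2r.
  by rewrite -mulrDl ler_wpM2r //; lra.
rewrite (bigID (mem s)) /= -[X in X + _ <= _]big_filter -[X in _ + X <= _]big_filter; apply: lerD.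
  apply: sum_subseq_le => //; try exact: filter_uniq.
  move=> j; rewrite mem_filter => /andP[js jt]; rewrite mem_filter js andbT.
  by have := tF j jt; rewrite /F /= js => ->.
apply: sT; first exact: filter_uniq.
by move=> j; rewrite mem_filter => /andP[].
Qed.
Lemma window_union (s : seq J) (col : J -> nat) (a : R) (m p : nat) : (p <= m)%N ->
  (forall c, (c < m)%N -> window N q kappa [seq j <- s | col j == c] a) -> forall y,
  p%:R * ((a - 60 * kappa * Num.sqrt a) * N y) <= fsum q [seq j <- s | (col j < p)%N] y <=
  p%:R * ((a + 60 * kappa * Num.sqrt a) * N y).
Proof.
move=> pm win y; elim: p pm => [|p IH] pm.
  by rewrite !mul0r /fsum big_filter big_pred0 ?lexx.
have /andP[i1 i2] := IH (ltnW pm); have /andP[w1 w2] := win p pm y.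
have -> : fsum q [seq j <- s | (col j < p.+1)%N] y =
    fsum q [seq j <- s | (col j < p)%N] y + fsum q [seq j <- s | col j == p] y.
  rewrite /fsum !big_filter (bigID (fun j => col j < p)%N) /=; congr (_ + _).
    by apply: eq_bigl => j; rewrite andbC ltnS; case: ltnP => //= /ltnW ->.
  by apply: eq_bigl => j; rewrite ltnS -leqNgt eqn_leq.
by apply/andP; split; rewrite -natr1 mulrDl mul1r; apply: lerD.
Qed.

(** Pieces at a level a with 1/n <= a < 2/n are joined until the total bound
is within a of 1.  With d = sqrt (1/n) = sqrt kappa, p pieces have total error
60 p kappa sqrt a <= 60 d p a <= 60 d, as d <= sqrt a and p a <= 1. *)
Lemma nearly_tight_subframe n : (120 ^ 2 <= n)%N -> kappa = n%:R^-1 ->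
  let d := Num.sqrt (n%:R^-1) in
  exists B, frame_on B (1 - 2 * n%:R^-1 - 60 * d) (1 + 60 * d).
Proof.
move=> n120 kE d; rewrite -kE in d *.
have d0 : 0 < d by rewrite /d sqrtr_gt0; exact: k0.
have gK := K1; have gk := k0.
have kd : kappa = d * d by rewrite -expr2 sqr_sqrtr // ltW.
have k120 : 120 ^+ 2 * kappa <= 1.
  rewrite kE ler_pdivrMr ?mul1r; last by rewrite -invr_gt0 -kE.
  by rewrite -natrX ler_nat.
have d120 : 120 * d <= 1.
  rewrite -(@expr_le1 _ 2) //; first by rewrite exprMn [d ^+ 2]expr2 -kd; exact: k120.
  by apply: mulr_ge0 => //; apply: ltW.
have kK : kappa <= K.
  have : kappa <= 120 ^+ 2 * kappa by rewrite ler_peMl ?ltW // exprn_egt1 ?ltr1n.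
  lra.
have [m [m1 m2]] := dyadic_level k0 kK; set a := K / 2 ^+ m in m1 m2.
have a0 : 0 < a by apply: lt_le_trans m1.
have da : d <= Num.sqrt a by rewrite ler_wsqrtr.
have ka : 120 * kappa <= Num.sqrt a.
  by apply: le_trans da; rewrite kd mulrA ler_piMl // ltW.
have [s [col [us cl cw sT]]] := frame_pieces ka.
have ia0 : 0 <= a^-1 by rewrite invr_ge0 ltW.
have /andP[p1 p2] := truncn_itv ia0; set p := Num.truncn _ in p1 p2.
have pa : p%:R * a <= 1 by rewrite -ler_pdivlMr // mul1r.
have pa' : 1 < (p%:R + 1) * a by rewrite natr1 -ltr_pdivrMr // mul1r.
have pm : (p <= 2 ^ m)%N.
  rewrite -(ler_nat R) natrX; apply: le_trans p1 _.
  by rewrite /a invf_div ler_pdivrMr ?ler_peMr ?exprn_ge0 //; lra.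
have err : p%:R * (kappa * Num.sqrt a) <= d.
  have h : p%:R * (kappa * Num.sqrt a) <= p%:R * (d * Num.sqrt a * Num.sqrt a).
    by rewrite ler_wpM2l // ler_wpM2r ?sqrtr_ge0 // kd ler_wpM2l // ltW.
  apply: le_trans h _; rewrite -mulrA -expr2 sqr_sqrtr; last exact: ltW.
  by rewrite mulrCA ler_piMr // ltW.
have win := window_union pm cw.
pose B : set J := [set j | j \in s /\ (col j < p)%N].
have BE y : \esum_(j in B) (q j y)%:E = (fsum q [seq j <- s | (col j < p)%N] y)%:E.
  apply/eqP; rewrite eq_le; apply/andP; split.
    apply: esum_le_seq => t ut tB; apply: sum_subseq_le => //; first exact: filter_uniq.
    by move=> j /tB [js jp]; rewrite mem_filter jp.
  apply: le_esum_seq => //; first exact: filter_uniq.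
  by move=> j; rewrite mem_filter => /andP[].
exists B; split; [|lra|move=> y; have /andP[w1 w2] := win y].
  have : kappa <= d by rewrite kd ger_pMl //; lra.
  have : 120 * kappa <= 120 ^+ 2 * kappa by rewrite ler_pM2r // expr2; lra.
  have : 120 * d < 120 by lra.
  lra.
rewrite BE !lee_fin; apply/andP; split.
  apply: le_trans w1; rewrite mulrA ler_wpM2r //.
  have -> : p%:R * (a - 60 * kappa * Num.sqrt a) =
      p%:R * a - 60 * (p%:R * (kappa * Num.sqrt a)) by ring.
  by rewrite mulrDl mul1r in pa'; lra.
apply: (le_trans w2); rewrite mulrA ler_wpM2r //.
have -> : p%:R * (a + 60 * kappa * Num.sqrt a) =
    p%:R * a + 60 * (p%:R * (kappa * Num.sqrt a)) by ring.
lra.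
Qed.
End AbstractFrames.

(** * Frames over real or complex scalars *)

Section FormTail.
Local Open Scope complex_scope.
Context {R : realType}.
Local Notation C := R[i].
Local Notation cj := (@conjc R).
Variables (F : numFieldType) (theta : F -> F) (iota : {rmorphism F -> C}).
Hypothesis iota_theta : forall z, iota (theta z) = cj (iota z).
Hypothesis iota_gt0 : forall z, 0 < z -> 0 < iota z.
Variables (H : vectType F) (form : {dot H for theta}).
Variables (J : choiceType) (x : J -> H) (K : R).
Let N y := sqnorm iota form y.
Let q j y := sqmod (gform iota form y (x j)).
Hypothesis tight : forall y, \esum_(j in [set: J]) (q j y)%:E = (K * N y)%:E.

(** On the vectors of a basis the tails of the convergent sums are small, and
[form_expansion] carries this over to all y. *)
Lemma form_tail : tail_small N q.
Proof.
move=> e e0; have [c c0 cE] := form_expansion iota_theta iota_gt0 form.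
pose n := \dim {:H}; pose b (i : 'I_n) := (vbasis {:H})`_i.
have q0 j y : 0 <= q j y by apply: sqmod_ge0.
have N0 y : 0 <= N y by apply: sqnorm_ge0.
pose e' := e / (c * (n%:R + 1)).
have cn : 0 < c * (n%:R + 1) by rewrite mulr_gt0 // ltr_wpDl.
have e'0 : 0 < e' by rewrite divr_gt0.
have /choice[t tE] : forall i, exists s, uniq s /\ K * N (b i) - e' < \sum_(j <- s) q j (b i).
  by move=> i; apply: esum_approx.
exists (undup (flatten [seq t i | i <- enum 'I_n])); split; first exact: undup_uniq.
move=> y A uA Adis.
have Ab i : \sum_(j <- A) q j (b i) <= e'.
  have [ut lt] := tE i.
  have : ((\sum_(j <- A ++ t i) q j (b i))%:E <= (K * N (b i))%:E)%E.
    rewrite -tight; apply: le_esum_seq => //.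
    rewrite cat_uniq uA ut andbT /=; apply/hasPn => j jt /=; apply/negP => /Adis.
    rewrite mem_undup => /negP; apply; apply/flattenP; exists (t i) => //.
    by apply: map_f; rewrite mem_enum.
  by rewrite lee_fin big_cat /=; lra.
apply: (@le_trans _ _ (\sum_(j <- A) c * N y * \sum_(i < n) q j (b i))).
  by apply: ler_sum => j _; apply: cE.
rewrite -mulr_sumr exchange_big /=.
apply: (@le_trans _ _ (c * N y * (n%:R * e'))).
  apply: ler_wpM2l; first by rewrite mulr_ge0 // ltW.
  apply: le_trans (ler_sum _ (fun i _ => Ab i)) _.
  by rewrite sumr_const card_ord mulr_natl.
have -> : c * N y * (n%:R * e') = N y * (n%:R / (n%:R + 1) * e).
  rewrite /e'; field; rewrite (gt_eqF c0) /= gt_eqF // ltr_wpDl //.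
rewrite [leRHS]mulrC; apply: ler_wpM2l => //.
by rewrite ger_pMl // ler_pdivrMr ?ltr_wpDl // mul1r lerDl.
Qed.
End FormTail.

Section Scalars.
Local Open Scope complex_scope.
Context {R : realType}.

Lemma frame_properties (s : scalars) (H : vectType (scalar_field R s))
    (dot : {dot H for @scalar_conj R s}) (J : choiceType) (x : J -> H) :
  let N y := hnorm dot y ^+ 2 in
  let q j y := scalar_re `|dot y (x j)| ^+ 2 in
  [/\ halvable N q, (forall j y, q j y <= N (x j) * N y) &
    forall K, (forall y, \esum_(j in [set: J]) (q j y)%:E = (K * N y)%:E) ->
      tail_small N q].
Proof.
move=> N q; case: s H dot x @N @q => H dot x N q.
- pose iota := (real_complex R : {rmorphism R -> R[i]}).
  have iota_theta (z : R) : iota (idfun z) = conjc (iota z).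
    by rewrite /iota /= oppr0.
  have iota_gt0 (z : R) : 0 < z -> 0 < iota z by rewrite /iota /= ltcR.
  have span : ((forall c : R[i], exists a b, c = iota a + 'i * iota b) /\
     (forall a b, sqmod (iota a + 'i * iota b) = sqmod (iota a) + sqmod (iota b)))
     \/ (forall c, exists a, c = iota a).
    left; split=> [[a b]|a b].
      exists a, b; apply/eqP; rewrite eq_complex /=; apply/andP; split; apply/eqP; ring.
    by rewrite /sqmod /=; ring.
  have NE : N = sqnorm iota dot.
    apply/funext => y; rewrite /N /hnorm sqr_sqrtr //.
    exact: (sqnorm_ge0 iota_theta iota_gt0 dot y).
  have qE : q = fun j y => sqmod (gform iota dot y (x j)).
    apply/funext => j; apply/funext => y; rewrite /q /gform /sqmod /=.
    by rewrite expr0n addr0 real_normK ?num_real.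
  rewrite NE qE; split.
  + exact: (halvable_form iota_theta iota_gt0 span).
  + by move=> j y; exact: (cauchy_schwarz iota_theta iota_gt0).
  + by move=> K tight; exact: (form_tail iota_theta iota_gt0 tight).
pose iota := (idfun : {rmorphism R[i] -> R[i]}).
have iota_theta (z : R[i]) : iota (Num.conj z) = conjc (iota z) by [].
have iota_gt0 (z : R[i]) : 0 < z -> 0 < iota z by [].
have span : ((forall c : R[i], exists a b, c = iota a + 'i * iota b) /\
   (forall a b, sqmod (iota a + 'i * iota b) = sqmod (iota a) + sqmod (iota b)))
   \/ (forall c, exists a, c = iota a) by right => c; exists c.
have NE : N = sqnorm iota dot.
  apply/funext => y; rewrite /N /hnorm sqr_sqrtr //.
  exact: (sqnorm_ge0 iota_theta iota_gt0 dot y).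
have qE : q = fun j y => sqmod (gform iota dot y (x j)).
  have nE (z : R[i]) : complex.Re `|z| ^+ 2 = sqmod z.
    by rewrite normc_def /= sqr_sqrtr // addr_ge0 ?sqr_ge0.
  by apply/funext => j; apply/funext => y; exact: nE.
rewrite NE qE; split.
+ exact: (halvable_form iota_theta iota_gt0 span).
+ by move=> j y; exact: (cauchy_schwarz iota_theta iota_gt0).
+ by move=> K tight; exact: (form_tail iota_theta iota_gt0 tight).
Qed.
End Scalars.

(** * Partitions and nearly tight subframes *)

Lemma cvg_inv_nat (R : realType) : (n%:R^-1 : R) @[n --> \oo] --> (0 : R).
Proof.
apply/cvgrPdist_le => e e0; near=> n.
rewrite sub0r normrN ger0_norm // invf_ple ?posrE ?ltr0n //.
- by near: n; apply: nbhs_infty_ger.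
- by near: n; exact: nbhs_infty_gt.
Unshelve. all: by end_near.
Qed.

Theorem theorem1p7 (R : realType) :
  (exists A B : R, [/\ 0 < A, 0 < B &
     forall (s : scalars) (H : vectType (scalar_field R s))
       (dot : {dot H for @scalar_conj R s})
       (J : choiceType) (x : J -> H) (K : R),
       (forall j, hball dot 1 (x j)) -> 1 < K -> is_tight_frame dot x K ->
       exists (D : set nat) (F : nat -> set J),
         partition D F [set: J] /\
         forall i, D i -> is_frame dot x (F i) A B])
  /\
  (exists A_ B_ : nat -> R,
     [/\ A_ n @[n --> \oo] --> (1 : R), B_ n @[n --> \oo] --> (1 : R) &
     forall (N : nat), (0 < N)%N ->
     forall (s : scalars) (H : vectType (scalar_field R s))
       (dot : {dot H for @scalar_conj R s})
       (J : choiceType) (x : J -> H) (K : R),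
       (forall j, hball dot (N%:R^-1) (x j)) -> 1 < K ->
       is_tight_frame dot x K ->
       exists J0 : set J, is_frame dot x J0 (A_ N) (B_ N)]).
Proof.
have tightE (s : scalars) (H : vectType (scalar_field R s))
    (dot : {dot H for @scalar_conj R s}) (J : choiceType) (x : J -> H) (K : R) :
    is_tight_frame dot x K -> forall y,
    \esum_(j in [set: J]) (scalar_re `|dot y (x j)| ^+ 2)%:E = (K * hnorm dot y ^+ 2)%:E.
  by move=> [_ _ E] y; apply/esym/eqP; rewrite eq_le; have /andP[-> ->] := E y.
have ballE (s : scalars) (H : vectType (scalar_field R s))
    (dot : {dot H for @scalar_conj R s}) (J : choiceType) (x : J -> H) (r : R) :
    (forall j, hball dot r (x j)) -> forall j y,
    scalar_re `|dot y (x j)| ^+ 2 <= r ^+ 2 * hnorm dot y ^+ 2.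
  move=> xr j y; have [_ cs _] := frame_properties dot x.
  apply: le_trans (cs j y) _; rewrite ler_wpM2r ?sqr_ge0 //.
  have h0 : 0 <= hnorm dot (x j) by exact: sqrtr_ge0.
  by rewrite lerXn2r ?nnegrE ?(le_trans h0 (xr j)) //; exact: xr.
have part1 (s : scalars) (H : vectType (scalar_field R s))
    (dot : {dot H for @scalar_conj R s}) (J : choiceType) (x : J -> H) (K : R) :
    (forall j, hball dot 1 (x j)) -> 1 < K -> is_tight_frame dot x K ->
    exists (D : set nat) (F : nat -> set J), partition D F [set: J] /\
      forall i, D i -> is_frame dot x (F i) 1 (4 * 120 ^+ 2).
  move=> x1 K1 tx; have [hv _ tl] := frame_properties dot x.
  have N0' y : 0 <= hnorm dot y ^+ 2 by exact: sqr_ge0.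
  have q0' j y : 0 <= scalar_re `|dot y (x j)| ^+ 2 by exact: sqr_ge0.
  exact: (partition_into_frames (N := fun y => hnorm dot y ^+ 2) ltr01 K1 N0' q0' hv
    (ballE _ _ _ _ _ _ x1) (tightE _ _ _ _ _ _ tx) (tl K (tightE _ _ _ _ _ _ tx)) erefl).
split.
  by exists 1, (4 * 120 ^+ 2).
pose A_ (n : nat) : R :=
  if (120 ^ 2 <= n)%N then 1 - 2 * n%:R^-1 - 60 * Num.sqrt (n%:R^-1) else 1.
pose B_ (n : nat) : R :=
  if (120 ^ 2 <= n)%N then 1 + 60 * Num.sqrt (n%:R^-1) else 4 * 120 ^+ 2.
have big : \forall n \near \oo, (120 ^ 2 <= n)%N by exact: nbhs_infty_ge.
have sq0 : (Num.sqrt (n%:R^-1) : R) @[n --> \oo] --> (0 : R).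
  rewrite -(sqrtr0 R); apply: continuous_cvg; last exact: cvg_inv_nat.
  exact: sqrt_continuous.
(* for small N, where the error terms are too large, the bounds of the first part are used *)
exists A_, B_; split.
- have lim : (1 - 2 * n%:R^-1 - 60 * Num.sqrt (n%:R^-1) : R) @[n --> \oo] -->
      (1 - 2 * 0 - 60 * 0 : R).
    by apply: cvgB; [apply: cvgB; [exact: cvg_cst|apply: cvgMr; exact: cvg_inv_nat]|apply: cvgMr].
  rewrite !mulr0 !subr0 in lim; apply: cvg_trans lim.
  by apply: near_eq_cvg; near=> n; rewrite /A_ (near big n).
- have lim : (1 + 60 * Num.sqrt (n%:R^-1) : R) @[n --> \oo] --> (1 + 60 * 0 : R).
    by apply: cvgD; [exact: cvg_cst|apply: cvgMr].
  rewrite mulr0 addr0 in lim; apply: cvg_trans lim.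
  by apply: near_eq_cvg; near=> n; rewrite /B_ (near big n).
move=> N N0 s H dot J x K xN K1 tx; rewrite /A_ /B_.
have iN0 : 0 < N%:R^-1 :> R by rewrite invr_gt0 ltr0n.
case: ifP => N120.
  have [hv _ tl] := frame_properties dot x.
  have N0' y : 0 <= hnorm dot y ^+ 2 by exact: sqr_ge0.
  have q0' j y : 0 <= scalar_re `|dot y (x j)| ^+ 2 by exact: sqr_ge0.
  exact: (nearly_tight_subframe (N := fun y => hnorm dot y ^+ 2) iN0 K1 N0' q0' hv
    (ballE _ _ _ _ _ _ xN) (tightE _ _ _ _ _ _ tx) (tl K (tightE _ _ _ _ _ _ tx)) N120 erefl).
have x1 j : hball dot 1 (x j).
  by apply: le_trans (xN j) _; rewrite invf_le1 ?ltr0n // ler1n.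
have [D [F [[cF _ _] fF]]] := part1 _ _ _ _ _ _ x1 K1 tx.
have [[i Di]|/forallNP D0] := pselect (exists i, D i).
  by exists (F i); apply: fF.
have noJ (j : J) : False.
  by have [i Di _] : cover D F j by [rewrite cF]; exact: (D0 i).
exists set0; split => // y.
have := tightE _ _ _ _ _ _ tx y.
have -> : [set: J] = set0 by apply/seteqP; split => // j _; case: (noJ j).
rewrite esum_set0 => -[] /esym/eqP; rewrite mulf_eq0 gt_eqF ?(lt_trans _ K1) //= => /eqP ->.
by rewrite !mulr0 lexx.
Unshelve. all: by end_near.
Qed.
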